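(* Consider the optimal attack design problem with $\delta=0$: $$\min_{\gamma(0,N)}\ \sum_{t=0}^N \operatorname{trace}\big(\widehat P Q_t\big)+\mathbb{E}\Big[\sum_{t=0}^N \|\mathcal H\xi_t\|_{Q_t}^2\Big]\quad\text{s.t.}\quad \|\epsilon_t\|_{\Sigma_\nu^{-1}}^2\le \delta=0,\ \ t=0,\dots,N,$$ where the minimum is over attack sequences $\gamma(0,N)=\{e_0,\dots,e_N\}$ in which each $e_t$ depends only on the information $\mathcal I_t$. An attack sequence that solves this problem is, for $t=0,\dots,N$, $$e_t=-\mathcal F_t\big(\mathcal F_t^T\mathcal B^T\mathbf Q_{t+1}\mathcal B\mathcal F_t\big)^\dagger\mathcal F_t^T\mathcal B^T\mathbf Q_{t+1}\big(\mathcal A-\mathcal B\mathcal D_t^\dagger\mathcal C_t\big)\xi_t-\mathcal D_t^\dagger\mathcal C_t\xi_t,$$ where $\mathcal C_N=\widetilde{\mathcal C}$, $\mathcal D_N=\widetilde{\mathcal D}$, $\mathcal F_N=I_s-\mathcal D_N^\dagger\mathcal D_N$, and, for $t=0,\dots,N-1$, $$\mathcal C_t=\begin{bmatrix}\widehat{\mathbf P}_{N-t}\mathcal G\mathcal A\\ \widetilde{\mathcal C}\end{bmatrix},\qquad \mathcal D_t=\begin{bmatrix}\widehat{\mathbf P}_{N-t}\widehat{\mathcal B}\\ \widetilde{\mathcal D}\end{bmatrix},\qquad \mathcal F_t=I_s-\mathcal D_t^\dagger\mathcal D_t,$$ and the matrices $\mathbf Q_t$ are given backward in time, with terminal condition $\mathbf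 Q_{N+1}=0$, by $$\begin{aligned}\mathbf Q_t={}&\mathcal H^TQ_t\mathcal H+(\mathcal A-\mathcal B\mathcal D_t^\dagger\mathcal C_t)^T\mathbf Q_{t+1}(\mathcal A-\mathcal B\mathcal D_t^\dagger\mathcal C_t)\\&-(\mathcal A-\mathcal B\mathcal D_t^\dagger\mathcal C_t)^T\mathbf Q_{t+1}\mathcal B\mathcal F_t\big(\mathcal F_t^T\mathcal B^T\mathbf Q_{t+1}\mathcal B\mathcal F_t\big)^\dagger\mathcal F_t^T\mathcal B^T\mathbf Q_{t+1}(\mathcal A-\mathcal B\mathcal D_t^\dagger\mathcal C_t).\end{aligned}$$
   Context: Notation: $M^\dagger$ is the Moore-Penrose pseudoinverse; for $S\succ0$, $\|x\|_S=\sqrt{x^TSx}$. System. $A\in\mathbb R^{n\times n}$, $B\in\mathbb R^{n\times m}$, $C\in\mathbb R^{p\times n}$, $\Gamma\in\mathbb R^{n\times s}$, $\Psi\in\mathbb R^{p\times s}$, with $(A,C)$ observable, $(A,B)$ controllable and $\begin{bmatrix}\Gamma\\ \Psi\end{bmatrix}$ injective. The dynamics are $$x_{t+1}=Ax_t+Bu_t+\Gamma e_t+w_t,\qquad y_t=Cx_t+\Psi e_t+v_t,$$ with $w_t\sim\mathcal N(0,\Sigma_w)$, $v_t\sim\mathcal N(0,\Sigma_v)$ i.i.d. in time and mutually independent, $\Sigma_w,\Sigma_v\succ0$. The system starts at time $-\infty$ with initial state $\mathcal N(0,\Sigma_x)$, $\Sigma_x\succ0$, independent of the noises, and $e_t=0$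 for $t<0$. The system runs the steady-state Kalman filter designed for $e_t\equiv0$: $\widehat x_t=\widehat x_{t|t-1}+K(y_t-C\widehat x_{t|t-1})$, $\widehat x_{t+1|t}=A\widehat x_t+Bu_t$, where $P\succeq0$ is the steady-state error covariance solving $P=APA^T+\Sigma_w-APC^T(CPC^T+\Sigma_v)^{-1}CPA^T$, and $K=PC^T(CPC^T+\Sigma_v)^{-1}$. The input is $u_t=L\widehat x_t$ with $L$ such that $A+BL$ is stable. Put $\Sigma_\nu=CPC^T+\Sigma_v$ and $\widehat P=P-PC^T\Sigma_\nu^{-1}CP$. Attacker. The horizon is $N$, the target state is $x^*\in\mathbb R^n$, and the weights are $Q_t\in\mathbb R^{n\times n}$, $Q_t\succ0$, $t=0,\dots,N$. Let $\widetilde y_t=Cx_t+v_t$. The information is $\mathcal I_0=\{\widetilde y_0\}$ (together with the outputs observed before time $0$, so that the pre-attack state estimate is known), $\mathcal I_{t+1}=\{\mathcal I_t,\widetilde y_{t+1},e_t\}$. Let $\widetilde x_t=\mathbb E[x_t\mid\mathcal I_t]$, let $\widetilde\nu_{t+1}=\widetilde y_{t+1}-C\,\mathbb E[x_{t+1}\mid\mathcal I_t,e_t]$ be the attacker's innovation (i.i.d. $\mathcal N(0,\Sigma_\nu)$, with $\widetilde\nu_{t+1}$ independent of $\mathcal I_t$), and let $\widehat x_t^0$ be the value the system's estimate $\widehat x_t$ would have if $e_0=\dots=e_t=0$. The bias $\epsilon_t\in\mathbb R^p$ induced by the attack in the system's innovation $y_t-C\widehat x_{t|t-1}$ satisfies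 $\theta_{t+1}=\widehat{\mathcal A}\theta_t+\widehat{\mathcal B}e_t$, $\epsilon_t=\widehat{\mathcal C}\theta_t+\widehat{\mathcal D}e_t$, $\theta_0=0\in\mathbb R^{3n}$, with $$\widehat{\mathcal A}=\begin{bmatrix}(I_n-KC)A+BL&KC&KC\\ ABL&A&0\\ 0&0&A\end{bmatrix},\quad\widehat{\mathcal B}=\begin{bmatrix}K\Psi\\ 0\\ \Gamma\end{bmatrix},\quad\widehat{\mathcal C}=\begin{bmatrix}-CA&C&C\end{bmatrix},\quad\widehat{\mathcal D}=\Psi.$$ Augmented state. $\xi_t=[\widetilde x_t^T\ \theta_t^T\ (\widehat x_t^0)^T\ {x^*}^T]^T\in\mathbb R^{6n}$, which is exactly determined by $\mathcal I_t$ and satisfies $\xi_{t+1}=\mathcal A\xi_t+\mathcal Be_t+\mathcal K\widetilde\nu_{t+1}$, $\epsilon_t=\widetilde{\mathcal C}\xi_t+\widetilde{\mathcal D}e_t$, $\widetilde x_t-x^*=\mathcal H\xi_t$, where, with $\Omega=[(I_n-KC)A+BL\ \ KC\ \ KC]$ and $\widetilde{\mathcal B}=\Gamma+BLK\Psi$, $$\mathcal A=\begin{bmatrix}A&BL\Omega&BL&0\\ 0&\widehat{\mathcal A}&0&0\\ 0&0&A+BL&0\\ 0&0&0&I_n\end{bmatrix},\ \mathcal B=\begin{bmatrix}\widetilde{\mathcal B}\\ \widehat{\mathcal B}\\ 0\\ 0\end{bmatrix},\ \mathcal K=\begin{bmatrix}K\\ 0\\ K\\ 0\end{bmatrix},$$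 $\widetilde{\mathcal C}=[0\ \widehat{\mathcal C}\ 0\ 0]$, $\widetilde{\mathcal D}=\Psi$, $\mathcal H=[I_n\ 0\ 0\ -I_n]$, and $\mathcal G=[0\ I_{3n}\ 0\ 0]$ (so $\mathcal G\xi_t=\theta_t$). Riccati matrices. $\widehat{\mathbf P}_0=0$ and $$\widehat{\mathbf P}_{k+1}=\widehat{\mathcal A}^T\widehat{\mathbf P}_k\widehat{\mathcal A}+\widehat{\mathcal C}^T\Sigma_\nu^{-1}\widehat{\mathcal C}-M_k^T\big(\widehat{\mathcal D}^T\Sigma_\nu^{-1}\widehat{\mathcal D}+\widehat{\mathcal B}^T\widehat{\mathbf P}_k\widehat{\mathcal B}\big)^\dagger M_k,\quad M_k=\widehat{\mathcal D}^T\Sigma_\nu^{-1}\widehat{\mathcal C}+\widehat{\mathcal B}^T\widehat{\mathbf P}_k\widehat{\mathcal A}.$$ The constraints on $\epsilon_t$ (random through the dependence of $e_t$ on $\mathcal I_t$) are understood to hold with probability one. *)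

(* Defs.v *)
From HB Require Import structures.
From mathcomp Require Import all_boot all_order all_algebra.
From mathcomp Require Import all_classical all_reals all_analysis.
From mathcomp.real_closed Require Import complex.
Set Implicit Arguments.
Unset Strict Implicit.
Unset Printing Implicit Defensive.
Import Order.TTheory GRing.Theory Num.Theory.
Local Open Scope classical_set_scope.
Local Open Scope ring_scope.

Section Matrices.
Variable R : realType.

Definition qform n (S : 'M[R]_n) (x : 'cV[R]_n) : R := (x^T *m S *m x) 0 0.

Definition posdef n (S : 'M[R]_n) : Prop :=
  S^T = S /\ forall x : 'cV[R]_n, x != 0 -> 0 < qform S x.

Definition possemidef n (S : 'M[R]_n) : Prop :=
  S^T = S /\ forall x : 'cV[R]_n, 0 <= qform S x.

Definition wnorm n (S : 'M[R]_n) (x : 'cV[R]_n) : R := Num.sqrt (qform S x).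

Definition penrose a b (M : 'M[R]_(a, b)) (X : 'M[R]_(b, a)) : Prop :=
  [/\ M *m X *m M = M, X *m M *m X = X,
      (M *m X)^T = M *m X & (X *m M)^T = X *m M].

(* The Penrose equations have exactly one solution, so the default value 0 is
   never used and the choice is immaterial. *)
Definition mpinv a b (M : 'M[R]_(a, b)) : 'M[R]_(b, a) :=
  xget 0 [set X | penrose M X].

Definition observable n p (A : 'M[R]_n) (C : 'M[R]_(p, n)) : Prop :=
  \rank (\mxcol_(k < n) (C *m (A ^+ k))) = n.

Definition controllable n m (A : 'M[R]_n) (B : 'M[R]_(n, m)) : Prop :=
  \rank (\mxrow_(k < n) ((A ^+ k) *m B)) = n.

Definition schur_stable n (M : 'M[R]_n) : Prop :=
  forall z : R[i],
    eigenvalue (map_mx (fun r : R => r%:C%C) M) z -> `|z| < 1.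

End Matrices.

Notation "M ^†" := (mpinv M) (at level 1, format "M ^†") : ring_scope.

Section Probability.
Context (R : realType) (d : measure_display) (T : measurableType d).
Variable Pr : probability T R.

(* Sigma-algebras on T are represented as sets of sets.  [vec_events X]
   generates the sigma-algebra of the random vector X; [vec_events X `<=` G]
   says that X is G-measurable. *)
Definition vec_events n (X : T -> 'cV[R]_n) : set (set T) :=
  [set E | exists (i : 'I_n) (D : set R),
     measurable D /\ E = [set w | D (X w i 0)]].

(* The law N(0, var) on R; normal_prob takes the standard deviation and is not
   the Dirac mass when that is 0. *)
Definition centered_normal (var : R) : set R -> \bar R :=
  if var == 0 then (fun D => \d_(0 : R) D)
  else (fun D => normal_prob 0 (Num.sqrt var) D).

(* X ~ N(0, S): every linear functional of X is univariate normal. *)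
Definition gaussian n (X : T -> 'cV[R]_n) (S : 'M[R]_n) : Prop :=
  forall a : 'cV[R]_n,
    measurable_fun setT (fun w => (a^T *m X w) 0 0 : R) /\
    forall D : set R, measurable D ->
      Pr [set w | D ((a^T *m X w) 0 0)] = centered_normal (qform S a) D.

Definition independent (G H : set (set T)) : Prop :=
  forall E F, G E -> H F -> Pr (E `&` F) = (Pr E * Pr F)%E.

Definition mutually_independent (I : eqType) (G : I -> set (set T)) : Prop :=
  forall (J : seq I) (E : I -> set T), uniq J -> (forall i, G i (E i)) ->
    Pr (\big[setI/setT]_(i <- J) E i) = (\prod_(i <- J) Pr (E i))%E.

(* Z is a version of E[X | G].  Attacks are not required to be integrable, so
   X need only be integrable on each set of a countable G-measurable cover of
   T; for an integrable X this is the usual conditional expectation. *)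
Definition is_condE (G : set (set T)) (X Z : T -> R) : Prop :=
  [/\ forall D : set R, measurable D -> G [set w | D (Z w)],
      exists F : nat -> set T,
        [/\ forall k, G (F k), \bigcup_k F k = setT &
            forall k, Pr.-integrable (F k) (EFin \o X)] &
      forall E, G E -> Pr.-integrable E (EFin \o X) ->
        (\int[Pr]_(w in E) (X w)%:E = \int[Pr]_(w in E) (Z w)%:E)%E].

(* A chosen version; any two versions agree almost surely. *)
Definition condE (G : set (set T)) (X : T -> R) : T -> R :=
  xget (fun=> 0) [set Z | is_condE G X Z].

Definition vcondE n (G : set (set T)) (X : T -> 'cV[R]_n) : T -> 'cV[R]_n :=
  fun w => \col_i condE G (fun w' => X w' i 0) w.

End Probability.

(* L is the feedback gain, covw and covv the noise covariances, covP the
   steady-state one-step prediction error covariance. *)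
Record plant (R : realType) (n m p s : nat) := Plant {
  matA : 'M[R]_n;
  matB : 'M[R]_(n, m);
  matC : 'M[R]_(p, n);
  matGamma : 'M[R]_(n, s);
  matPsi : 'M[R]_(p, s);
  covw : 'M[R]_n;
  covv : 'M[R]_p;
  covP : 'M[R]_n;
  gainL : 'M[R]_(m, n)
}.

Section PlantMatrices.
Context (R : realType) (n m p s : nat).
Variable S : plant R n m p s.
Local Notation A := (matA S).
Local Notation B := (matB S).
Local Notation C := (matC S).
Local Notation Gamma := (matGamma S).
Local Notation Psi := (matPsi S).
Local Notation P := (covP S).
Local Notation L := (gainL S).

Definition covnu : 'M[R]_p := C *m P *m C^T + covv S.
Definition gainK : 'M[R]_(n, p) := P *m C^T *m invmx covnu.
Definition covPhat : 'M[R]_n := P - P *m C^T *m invmx covnu *m C *m P.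
Local Notation K := gainK.

Definition riccati_P : Prop :=
  P = A *m P *m A^T + covw S
      - A *m P *m C^T *m invmx (C *m P *m C^T + covv S) *m C *m P *m A^T.

Definition Omega : 'M[R]_(n, n + (n + n)) :=
  row_mx ((1%:M - K *m C) *m A + B *m L) (row_mx (K *m C) (K *m C)).

Definition Ahat : 'M[R]_(n + (n + n)) :=
  col_mx Omega
    (col_mx (row_mx (A *m B *m L) (row_mx A 0))
            (row_mx 0 (row_mx 0 A))).
Definition Bhat : 'M[R]_(n + (n + n), s) :=
  col_mx (K *m Psi) (col_mx 0 Gamma).
Definition Chat : 'M[R]_(p, n + (n + n)) :=
  row_mx (- (C *m A)) (row_mx C C).
Definition Dhat : 'M[R]_(p, s) := Psi.

(* The augmented state space R^(6n), split as n + (3n + (n + n)). *)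
Definition dimxi : nat := n + ((n + (n + n)) + (n + n)).

Definition Btilde : 'M[R]_(n, s) := Gamma + B *m L *m K *m Psi.
Definition calA : 'M[R]_dimxi :=
  col_mx (row_mx A (row_mx (B *m L *m Omega) (row_mx (B *m L) 0)))
 (col_mx (row_mx 0 (row_mx Ahat 0))
 (col_mx (row_mx 0 (row_mx 0 (row_mx (A + B *m L) 0)))
         (row_mx 0 (row_mx 0 (row_mx 0 1%:M))))).
Definition calB : 'M[R]_(dimxi, s) :=
  col_mx Btilde (col_mx Bhat (col_mx 0 0)).
Definition Ctilde : 'M[R]_(p, dimxi) :=
  row_mx 0 (row_mx Chat (row_mx 0 0)).
Definition Dtilde : 'M[R]_(p, s) := Psi.
Definition calH : 'M[R]_(n, dimxi) :=
  row_mx 1%:M (row_mx 0 (row_mx 0 (- 1%:M))).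
Definition calG : 'M[R]_(n + (n + n), dimxi) :=
  row_mx 0 (row_mx 1%:M (row_mx 0 0)).

Fixpoint riccPhat (k : nat) : 'M[R]_(n + (n + n)) :=
  if k is k'.+1 then
    let Pk := riccPhat k' in
    let Si := invmx covnu in
    let Mk := Dhat^T *m Si *m Chat + Bhat^T *m Pk *m Ahat in
    Ahat^T *m Pk *m Ahat + Chat^T *m Si *m Chat
    - Mk^T *m (Dhat^T *m Si *m Dhat + Bhat^T *m Pk *m Bhat)^† *m Mk
  else 0.

Variable N : nat.

(* C_t and D_t for t < N; at t = N they have fewer rows, and enter only through
   D_t^† C_t and I - D_t^† D_t below. *)
Definition calC (t : nat) : 'M[R]_((n + (n + n)) + p, dimxi) :=
  col_mx (riccPhat (N - t) *m calG *m calA) Ctilde.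
Definition calD (t : nat) : 'M[R]_((n + (n + n)) + p, s) :=
  col_mx (riccPhat (N - t) *m Bhat) Dtilde.

Definition calDC (t : nat) : 'M[R]_(s, dimxi) :=
  if (t < N)%N then (calD t)^† *m calC t else Dtilde^† *m Ctilde.
Definition calF (t : nat) : 'M[R]_s :=
  if (t < N)%N then 1%:M - (calD t)^† *m calD t
  else 1%:M - Dtilde^† *m Dtilde.
Definition calAcl (t : nat) : 'M[R]_dimxi := calA - calB *m calDC t.

Variable Q : nat -> 'M[R]_n.

(* [riccQ_togo k] is the matrix bold-Q_t with t = N + 1 - k. *)
Fixpoint riccQ_togo (k : nat) : 'M[R]_dimxi :=
  if k is k'.+1 then
    let t := (N - k')%N in
    let Qn := riccQ_togo k' in
    let F := calF t in
    let X := calAcl t in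
    calH^T *m Q t *m calH + X^T *m Qn *m X
    - X^T *m Qn *m calB *m F *m (F^T *m calB^T *m Qn *m calB *m F)^†
        *m F^T *m calB^T *m Qn *m X
  else 0.
Definition riccQ (t : nat) : 'M[R]_dimxi := riccQ_togo (N.+1 - t).

Definition attack_law (t : nat) (xi : 'cV[R]_dimxi) : 'cV[R]_s :=
  let F := calF t in
  let Qn := riccQ t.+1 in
  - (F *m (F^T *m calB^T *m Qn *m calB *m F)^† *m F^T *m calB^T *m Qn
       *m (calA - calB *m calDC t) *m xi)
  - calDC t *m xi.

End PlantMatrices.

(* Time 0 is the start of the attack.  [init_x] is x_0, [init_pred] is the
   prediction of x_0 from the outputs before time 0, and [past_y k] is the
   output y_(-1-k). *)
Record disturbances (R : realType) (n p : nat) (T : Type) := Disturbances {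
  noise_w : nat -> T -> 'cV[R]_n;
  noise_v : nat -> T -> 'cV[R]_p;
  init_x : T -> 'cV[R]_n;
  init_pred : T -> 'cV[R]_n;
  past_y : nat -> T -> 'cV[R]_p
}.

Section ClosedLoop.
Context (R : realType) (n m p s : nat).
Context (d : measure_display) (T : measurableType d).
Variable Pr : probability T R.
Variable S : plant R n m p s.
Variable W : disturbances R n p T.
Local Notation A := (matA S).
Local Notation B := (matB S).
Local Notation C := (matC S).
Local Notation Gamma := (matGamma S).
Local Notation Psi := (matPsi S).
Local Notation L := (gainL S).
Local Notation K := (gainK S).

Section Trajectories.
Variable e : nat -> T -> 'cV[R]_s.

(* The pair of x_t and the system's prediction of x_t from y_0, ..., y_(t-1)
   and the outputs before time 0. *)
Fixpoint loop (t : nat) (w : T) : 'cV[R]_n * 'cV[R]_n :=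
  if t is t'.+1 then
    let x := (loop t' w).1 in
    let xp := (loop t' w).2 in
    let y := C *m x + Psi *m e t' w + noise_v W t' w in
    let xh := xp + K *m (y - C *m xp) in
    let u := L *m xh in
    (A *m x + B *m u + Gamma *m e t' w + noise_w W t' w,
     A *m xh + B *m u)
  else (init_x W w, init_pred W w).

Definition state t w : 'cV[R]_n := (loop t w).1.
Definition prediction t w : 'cV[R]_n := (loop t w).2.
Definition output t w : 'cV[R]_p :=
  C *m state t w + Psi *m e t w + noise_v W t w.
Definition innovation t w : 'cV[R]_p := output t w - C *m prediction t w.
Definition estimate t w : 'cV[R]_n :=
  prediction t w + K *m innovation t w.

Definition ytilde t w : 'cV[R]_p := C *m state t w + noise_v W t w.

Definition info (t : nat) : set (set T) :=
  <<s (\bigcup_k vec_events (past_y W k))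
      `|` (\bigcup_(k in [set k | (k <= t)%N]) vec_events (ytilde k))
      `|` (\bigcup_(k in [set k | (k < t)%N]) vec_events (e k)) >>.

Definition xtilde (t : nat) : T -> 'cV[R]_n := vcondE Pr (info t) (state t).

Fixpoint theta (t : nat) (w : T) : 'cV[R]_(n + (n + n)) :=
  if t is t'.+1 then Ahat S *m theta t' w + Bhat S *m e t' w else 0.

End Trajectories.

Definition no_attack : nat -> T -> 'cV[R]_s := fun _ _ => 0.

Definition bias e t w : 'cV[R]_p := innovation e t w - innovation no_attack t w.

Definition xi (xstar : 'cV[R]_n) e t w : 'cV[R]_(dimxi n) :=
  col_mx (xtilde e t w)
    (col_mx (theta e t w) (col_mx (estimate no_attack t w) xstar)).

(* Pre-attack history with x_0, and the process and measurement noise. *)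
Definition sources (i : option (bool * nat)) : set (set T) :=
  match i with
  | None =>
      <<s (\bigcup_k vec_events (past_y W k)) `|` vec_events (init_x W) >>
  | Some (true, t) => <<s vec_events (noise_w W t) >>
  | Some (false, t) => <<s vec_events (noise_v W t) >>
  end.

Definition noise_model : Prop :=
  [/\ forall k, vec_events (past_y W k) `<=` measurable,
      forall t, gaussian Pr (noise_w W t) (covw S),
      forall t, gaussian Pr (noise_v W t) (covv S) &
      mutually_independent Pr sources].

(* Outputs of the unattacked system before time t. *)
Definition nominal_past (t : nat) : set (set T) :=
  <<s (\bigcup_k vec_events (past_y W k))
      `|` (\bigcup_(k in [set k | (k < t)%N])
             vec_events (output no_attack k)) >>.

(* The unattacked system has been running its filter since time -oo, so at
   every time t >= 0 the filter is in steady state: the predicted and filtered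
   states are the conditional means given the outputs, with errors of
   covariance P and Phat independent of those outputs.  The prediction at time
   0 is a function of the outputs before 0, distributed according to the
   stationary law of (A + B L) (prediction + K innovation). *)
Definition steady_state : Prop :=
  [/\ vec_events (init_pred W)
        `<=` <<s \bigcup_k vec_events (past_y W k) >>,
      exists Sx : 'M[R]_n,
        [/\ possemidef Sx,
            Sx = (A + B *m L) *m (Sx + K *m covnu S *m K^T)
                   *m (A + B *m L)^T &
            gaussian Pr (init_pred W) Sx],
      forall t,
        let err := fun w => state no_attack t w - prediction no_attack t w in
        gaussian Pr err (covP S) /\
        independent Pr <<s vec_events err >> (nominal_past t) &
      forall t,
        let err := fun w => state no_attack t w - estimate no_attack t w in
        gaussian Pr err (covPhat S) /\
        independent Pr <<s vec_events err >> (nominal_past t.+1)].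

Variable N : nat.

(* e_t is a function of the information available at time t. *)
Definition admissible (e : nat -> T -> 'cV[R]_s) : Prop :=
  forall t, (t <= N)%N -> vec_events (e t) `<=` info e t.

Definition feasible (delta : R) (e : nat -> T -> 'cV[R]_s) : Prop :=
  forall t, (t <= N)%N ->
    {ae Pr, forall w, wnorm (invmx (covnu S)) (bias e t w) ^+ 2 <= delta}.

Variables (xstar : 'cV[R]_n) (Q : nat -> 'M[R]_n).

Definition cost (e : nat -> T -> 'cV[R]_s) : \bar R :=
  ((\sum_(t < N.+1) \tr (covPhat S *m Q t))%R%:E
   + 'E_Pr[fun w => (\sum_(t < N.+1)
             wnorm (Q t) (calH R n *m xi xstar e t w) ^+ 2)%R])%E.

Definition solves (delta : R) (e : nat -> T -> 'cV[R]_s) : Prop :=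
  [/\ admissible e, feasible delta e &
      forall e', admissible e' -> feasible delta e' -> (cost e <= cost e')%E].

Definition follows_law (e : nat -> T -> 'cV[R]_s) : Prop :=
  forall t, (t <= N)%N ->
    forall w, e t w = attack_law S N Q t (xi xstar e t w).

End ClosedLoop.

(* Main.v *)
From HB Require Import structures.
Require Import Defs.
From mathcomp Require Import all_boot all_order all_algebra.
From mathcomp Require Import all_classical all_reals all_analysis.
From mathcomp Require Import measurable_realfun.
From mathcomp Require Import ring lra.
Set Implicit Arguments.
Unset Strict Implicit.
Unset Printing Implicit Defensive.
Import Order.TTheory GRing.Theory Num.Theory.
Local Open Scope classical_set_scope.
Local Open Scope ring_scope.

(** The problem is a linear-quadratic one with hard linear constraints, and the
    proof is dynamic programming in which each ingredient is made exact.

    Separation.  Subtracting the unattacked trajectory from the attacked one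
    leaves a noise-free linear system driven by the attack, whose state is
    theta ([loop_theta], [bias_theta]).  An admissible attack is therefore a
    function of the unattacked outputs, so the attacker never knows more than
    these outputs ([info_past]), and the conditional mean of the state is the
    unattacked Kalman estimate plus a known linear function of theta
    ([xtilde_kalman]).  Hence xi coincides almost surely with the closed form
    [kalman_xi], which obeys the recursion xi' = A xi + B e + J a, where a is
    the correction that the unattacked filter makes at the next step
    ([kalman_xiS]).

    The noise decouples.  The correction is the difference of the prediction
    error and the filtering error.  Each of these is Gaussian, hence symmetric,
    and independent of the information available so far.  A symmetric variable
    is orthogonal to every variable independent of it
    ([symmetric_orthogonal]), so for a positive semidefinite form q and a known
    vector z the mean of q (z + J a) is the mean of q z plus a constant that no
    attack can influence ([mean_qform_shift]).  This is proved with values in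
    [0, +oo], since an admissible attack need not have finite second moments.

    The constraint.  Zero bias until the end of the horizon is possible exactly
    when theta lies in the kernel of the Riccati matrix of that many remaining
    steps, because the associated quadratic form is the least energy of the
    bias ([riccPhat_kerP]).  So a feasible attack keeps theta in these kernels,
    which is a linear equation D_t e_t = - C_t xi_t, and its solutions are
    parametrized by means of the pseudo-inverse of D_t ([silent_param]); the
    proposed law picks one of them ([silent_sat]).

    Optimality.  Completing the square ([qform_schur]) shows that the value
    form is at most the stage cost plus the value form of the next state, for
    every attack that satisfies the constraint ([bellman_le]), with equality
    for the law ([bellman_eq]).  Taking means, using the decoupling, and
    telescoping gives the same lower bound for the cost of all feasible attacks
    ([total_stage_ge]), which the law attains ([total_stage_law]). *)

(** * Quadratic forms and pseudo-inverses *)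

Section QuadraticForms.
Variable R : realType.

Lemma trmx11 (M : 'M[R]_1) : M^T = M.
Proof. by apply/matrixP => i j; rewrite mxE !ord1. Qed.

Lemma trmxD a b (M N : 'M[R]_(a, b)) : (M + N)^T = M^T + N^T.
Proof. exact: raddfD. Qed.

Lemma trmxB a b (M N : 'M[R]_(a, b)) : (M - N)^T = M^T - N^T.
Proof. exact: raddfB. Qed.

Lemma trmxN a b (M : 'M[R]_(a, b)) : (- M)^T = - M^T.
Proof. exact: raddfN. Qed.

Lemma trmxZ a b c (M : 'M[R]_(a, b)) : (c *: M)^T = c *: M^T.
Proof. exact: linearZ. Qed.

Lemma qformD n (S : 'M[R]_n) (x y : 'cV[R]_n) : S^T = S ->
  qform S (x + y) = qform S x + qform S y + ((x^T *m S *m y) 0 0) *+ 2.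
Proof.
move=> symS; rewrite /qform trmxD !mulmxDl !mulmxDr.
have -> : y^T *m S *m x = x^T *m S *m y.
  by rewrite -[LHS]trmx11 !trmx_mul trmxK symS mulmxA.
rewrite [LHS]mxE [X in X + _]mxE [X in _ + X]mxE; ring.
Qed.

Lemma qformZ n (S : 'M[R]_n) a (x : 'cV[R]_n) : qform S (a *: x) = a ^+ 2 * qform S x.
Proof.
by rewrite /qform trmxZ -!scalemxAl -scalemxAr scalerA mxE -expr2.
Qed.

Lemma qform_mulmx n k (S : 'M[R]_n) (M : 'M[R]_(n, k)) (x : 'cV[R]_k) :
  qform S (M *m x) = qform (M^T *m S *m M) x.
Proof. by rewrite /qform trmx_mul !mulmxA. Qed.

Lemma qform0 n (S : 'M[R]_n) : qform S 0 = 0.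
Proof. by rewrite /qform mulmx0 mxE. Qed.

Lemma qform_ker n (S : 'M[R]_n) (x : 'cV[R]_n) : S *m x = 0 -> qform S x = 0.
Proof. by move=> Sx; rewrite /qform -mulmxA Sx mulmx0 mxE. Qed.

Lemma sqnorm_eq0 n (x : 'cV[R]_n) : (x^T *m x) 0 0 = 0 -> x = 0.
Proof.
rewrite mxE => /eqP; rewrite psumr_eq0; last by move=> i _; rewrite mxE -expr2 sqr_ge0.
move=> /allP x0; apply/matrixP => i j; rewrite ord1 !mxE.
by have := x0 i (mem_index_enum _); rewrite mxE /= -expr2 sqrf_eq0 => /eqP.
Qed.

Lemma possemidef0 n : possemidef (0 : 'M[R]_n).
Proof. by split=> [|x]; rewrite ?trmx0 // /qform mulmx0 mul0mx mxE. Qed.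

Lemma posdef_semidef n (S : 'M[R]_n) : posdef S -> possemidef S.
Proof.
move=> [symS S_gt0]; split=> // x; have [->|/S_gt0 /ltW //] := eqVneq x 0.
by rewrite /qform mulmx0 mxE.
Qed.

Lemma possemidef_conj n k (S : 'M[R]_n) (M : 'M[R]_(n, k)) :
  possemidef S -> possemidef (M^T *m S *m M).
Proof.
move=> [symS S_ge0]; split=> [|x]; last by rewrite -qform_mulmx.
by rewrite !trmx_mul trmxK symS mulmxA.
Qed.

Lemma qform_addmx n (S S' : 'M[R]_n) (x : 'cV[R]_n) :
  qform (S + S') x = qform S x + qform S' x.
Proof. by rewrite /qform mulmxDr mulmxDl mxE. Qed.

Lemma possemidefD n (S S' : 'M[R]_n) :
  possemidef S -> possemidef S' -> possemidef (S + S').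
Proof.
move=> [sS S0] [sS' S'0]; split=> [|x]; first by rewrite trmxD sS sS'.
by rewrite qform_addmx addr_ge0.
Qed.

(** The parabola tau |-> c tau^2 + 2 b tau is tested at tau = - b / (c + 1), which
    makes sense also when c = 0. *)
Lemma quadratic_ge0_linear0 (b c : R) : 0 <= c ->
  0 <= 0 + (- (b / (c + 1))) ^+ 2 * c + - (b / (c + 1)) * b *+ 2 -> b = 0.
Proof.
move=> c0.
have -> : 0 + (- (b / (c + 1))) ^+ 2 * c + - (b / (c + 1)) * b *+ 2
          = - (b ^+ 2 * (c + 2)) / (c + 1) ^+ 2 by field; lra.
rewrite pmulr_lge0; last by rewrite invr_gt0 exprn_gt0 //; lra.
rewrite oppr_ge0 pmulr_lle0; last by lra.
by move=> hb; apply/eqP; rewrite -sqrf_eq0 eq_le hb sqr_ge0.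
Qed.

(** Along the line x + t S x the form is a quadratic polynomial in t without
    constant term; as it stays nonnegative, its linear coefficient, twice the
    squared norm of S x, vanishes. *)
Lemma possemidef_ker n (S : 'M[R]_n) (x : 'cV[R]_n) :
  possemidef S -> qform S x = 0 -> S *m x = 0.
Proof.
move=> [symS S_ge0] q0; apply: sqnorm_eq0.
set y := S *m x; set b : R := (y^T *m y) 0 0; set c : R := qform S y.
have c0 : 0 <= c by exact: S_ge0.
have := S_ge0 (x + (- (b / (c + 1))) *: y).
rewrite qformD // q0 qformZ -scalemxAr.
have -> : x^T *m S *m y = y^T *m y by rewrite /y trmx_mul symS mulmxA.
by rewrite [X in X *+ 2]mxE -/b -/c; exact: quadratic_ge0_linear0.
Qed.

Lemma possemidef_ker_mx n k (S : 'M[R]_n) (M : 'M[R]_(n, k)) :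
  possemidef S -> M^T *m S *m M = 0 -> S *m M = 0.
Proof.
move=> psdS M0; apply/trmx_inj/row_matrixP => i; rewrite trmx0 row0 -tr_col.
apply: trmx_inj; rewrite trmxK trmx0 colE -mulmxA; apply: possemidef_ker => //.
by rewrite qform_mulmx M0 /qform mulmx0 mul0mx mxE.
Qed.

Lemma qform_block n k (S : 'M[R]_n) (S' : 'M[R]_k) x y :
  qform (block_mx S 0 0 S') (col_mx x y) = qform S x + qform S' y.
Proof.
rewrite /qform tr_col_mx mul_row_block !mulmx0 add0r addr0 mul_row_col.
by rewrite mxE.
Qed.

Lemma possemidef_block n k (S : 'M[R]_n) (S' : 'M[R]_k) :
  possemidef S -> possemidef S' -> possemidef (block_mx S 0 0 S').
Proof.
move=> [sS S0] [sS' S'0]; split; first by rewrite tr_block_mx sS sS' !trmx0.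
by move=> x; rewrite -[x]vsubmxK qform_block addr_ge0.
Qed.

Lemma posdef_unit n (S : 'M[R]_n) : posdef S -> S \in unitmx.
Proof.
move=> [symS S_gt0]; rewrite -row_free_unit -kermx_eq0; apply/eqP/row_matrixP => i.
rewrite row0; apply: trmx_inj; rewrite trmx0; apply/eqP/negPn/negP => /S_gt0.
rewrite /qform trmxK -row_mul mulmx_ker row0 mul0mx mxE ltxx //.
Qed.

Lemma posdef_inv n (S : 'M[R]_n) : posdef S -> posdef (invmx S).
Proof.
move=> pS; have uS := posdef_unit pS; have [symS S_gt0] := pS.
have sI : (invmx S)^T = invmx S by rewrite trmx_inv symS.
split=> // x x0.
have -> : invmx S = (invmx S)^T *m S *m invmx S by rewrite sI mulVmx // mul1mx.
rewrite -qform_mulmx; apply: S_gt0; apply: contra_neq x0 => /(congr1 (mulmx S)).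
by rewrite mulKVmx // mulmx0.
Qed.

(** If v annihilates M M^T then v M has norm 0; this is where the scalars must be
    real. *)
Lemma gram_unit n k (M : 'M[R]_(n, k)) : row_free M -> M *m M^T \in unitmx.
Proof.
move=> freeM; rewrite -row_free_unit -kermx_eq0; apply/eqP/row_matrixP => i.
rewrite row0; set v := row i _.
have : v *m (M *m M^T) = 0 by rewrite -row_mul mulmx_ker row0.
move=> /(congr1 (mulmx^~ v^T)); rewrite mul0mx !mulmxA -mulmxA -trmx_mul => h.
have : v *m M = 0.
  apply: trmx_inj; rewrite trmx0; apply: sqnorm_eq0.
  by rewrite trmxK h mxE.
by move=> h0; apply: (row_free_inj freeM); rewrite h0 mul0mx.
Qed.

(** The witness is the product of the right inverse M^T (M M^T)^-1 and the left
    inverse (L^T L)^-1 L^T. *)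
Lemma penrose_full_rank n r k (L : 'M[R]_(n, r)) (M : 'M[R]_(r, k)) :
  row_full L -> row_free M -> exists X, penrose (L *m M) X.
Proof.
move=> fullL freeM.
have uL : L^T *m L \in unitmx.
  rewrite -{2}[L]trmxK; apply: gram_unit.
  by rewrite /row_free mxrank_tr.
have uM : M *m M^T \in unitmx by exact: gram_unit.
pose X := M^T *m invmx (M *m M^T) *m (invmx (L^T *m L) *m L^T).
have LX : L *m M *m X = L *m invmx (L^T *m L) *m L^T.
  by rewrite /X !mulmxA -[L *m M *m M^T]mulmxA mulmxK.
have XM : X *m (L *m M) = M^T *m invmx (M *m M^T) *m M.
  by rewrite /X !mulmxA -[_ *m L^T *m L]mulmxA mulmxKV.
exists X; split.
- by rewrite LX !mulmxA -[_ *m L^T *m L]mulmxA mulmxKV.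
- by rewrite XM /X !mulmxA -[_ *m M *m M^T]mulmxA mulmxKV.
- by rewrite LX !trmx_mul trmxK trmx_inv trmx_mul trmxK mulmxA.
- by rewrite XM !trmx_mul trmxK trmx_inv trmx_mul trmxK mulmxA.
Qed.

Lemma mpinvP n k (M : 'M[R]_(n, k)) : penrose M (M^†).
Proof.
suff [X pX] : exists X, penrose M X.
  by apply: (@xgetPex _ 0 [set X | penrose M X]); exists X.
have := penrose_full_rank (col_base_full M) (row_base_free M).
by rewrite mulmx_base.
Qed.

Lemma mpinv_sandwich n k (S : 'M[R]_n) (Z : 'M[R]_(n, k)) :
  Z^T *m S *m S^† *m (S *m Z) = Z^T *m S *m Z.
Proof.
have [SXS _ _ _] := mpinvP S.
by rewrite !mulmxA -[Z^T *m S *m _]mulmxA -[Z^T *m _ *m S]mulmxA SXS.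
Qed.

(** Minimization of the form Q over the affine space Y x + G f, where f is free.
    All Riccati recursions of the problem are instances of it. *)
Section CompleteSquare.
Variables (a b c : nat) (Q : 'M[R]_a) (Y : 'M[R]_(a, b)) (G : 'M[R]_(a, c)).
Hypothesis psdQ : possemidef Q.
Let S := G^T *m Q *m G.

(** Although S may be singular, the columns of G^T Q lie in its range: the
    projection D = S S^+ - 1 satisfies D S D = 0, that is (G D)^T Q (G D) = 0, so
    Q G D = 0 because Q is semidefinite.  Hence the stationarity equation
    S f = - G^T Q Y x is always solvable. *)
Lemma mpinv_range : S *m S^† *m (G^T *m Q) = G^T *m Q.
Proof.
have [symQ _] := psdQ; have [SXS _ symSX _] := mpinvP S.
have psdS : possemidef S by exact: possemidef_conj.
have symS : S^T = S by case: psdS.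
pose D := S *m S^† - 1%:M.
have DS : D *m S = 0 by rewrite mulmxBl SXS mul1mx subrr.
have symD : D^T = D by rewrite trmxB symSX trmx1.
have QGD : Q *m (G *m D) = 0.
  apply: possemidef_ker_mx => //; rewrite trmx_mul symD.
  have -> : D *m G^T *m Q *m (G *m D) = D *m S *m D by rewrite /S !mulmxA.
  by rewrite DS mul0mx.
have := congr1 trmx QGD; rewrite !trmx_mul symD symQ trmx0.
by rewrite -mulmxA mulmxBl mul1mx => /subr0_eq.
Qed.

(** The generalized Schur complement of S in the Gram matrix of (Y, G) for Q. *)
Definition schur := Y^T *m Q *m Y - Y^T *m Q *m G *m S^† *m (G^T *m Q *m Y).
Definition minimizer (x : 'cV[R]_b) := - (S^† *m (G^T *m Q *m Y *m x)).

(** The cross term is absorbed into the square because S (S^+ G^T Q Y x) equals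
    G^T Q Y x, by [mpinv_range]. *)
Lemma qform_schur x f :
  qform Q (Y *m x + G *m f) = qform schur x + qform S (f - minimizer x).
Proof.
have [symQ _] := psdQ; have [SXS _ symSX _] := mpinvP S.
have psdS : possemidef S by exact: possemidef_conj.
have symS : S^T = S by case: psdS.
rewrite /minimizer opprK; set g := G^T *m Q *m Y *m x; set h := S^† *m g.
have Sh : S *m h = g.
  by rewrite /h /g !mulmxA -[S *m _ *m G^T *m Q]mulmxA mpinv_range.
have gT : x^T *m Y^T *m Q *m G = g^T by rewrite /g !trmx_mul trmxK symQ !mulmxA.
rewrite qformD // !qform_mulmx qformD // -/S.
have -> : f^T *m S *m h = f^T *m g by rewrite -mulmxA Sh.
have -> : (Y *m x)^T *m Q *m (G *m f) = f^T *m g.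
  by rewrite trmx_mul !mulmxA gT -[LHS]trmx11 trmx_mul trmxK /g !mulmxA.
have -> : qform S h = (h^T *m g) 0 0 by rewrite /qform -mulmxA Sh.
have -> : qform schur x = qform (Y^T *m Q *m Y) x - (h^T *m g) 0 0.
  rewrite /schur qform_addmx; congr (_ + _).
  rewrite /qform mulmxN mulNmx mxE !mulmxA gT -!mulmxA [G^T *m _]mulmxA.
  by rewrite [_ *m Q *m _]mulmxA -/g -/h -[g^T *m h]trmx11 trmx_mul trmxK.
ring.
Qed.

Lemma qform_schur_le x f : qform schur x <= qform Q (Y *m x + G *m f).
Proof.
rewrite qform_schur lerDl; have [_] : possemidef S by exact: possemidef_conj.
exact.
Qed.

Lemma qform_schur_min x :
  qform Q (Y *m x + G *m minimizer x) = qform schur x.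
Proof. by rewrite qform_schur subrr qform0 addr0. Qed.

Lemma possemidef_schur : possemidef schur.
Proof.
have [symQ Q_ge0] := psdQ; have [SXS _ symSX _] := mpinvP S.
have symS : S^T = S by have [] : possemidef S by exact: possemidef_conj.
split=> [|x]; last by rewrite -qform_schur_min; exact: Q_ge0.
pose Z := S^† *m (G^T *m Q *m Y).
have GQY : G^T *m Q *m Y = S *m Z by rewrite /Z -{1}mpinv_range !mulmxA.
have YQG : Y^T *m Q *m G = Z^T *m S.
  have -> : Z^T *m S = (S *m Z)^T by rewrite [RHS]trmx_mul symS.
  by rewrite -GQY !trmx_mul trmxK symQ mulmxA.
have psdS : possemidef S by exact: possemidef_conj.
rewrite /schur GQY YQG mpinv_sandwich trmxB.
by have [-> _] := possemidef_conj Y psdQ; have [-> _] := possemidef_conj Z psdS.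
Qed.

End CompleteSquare.
End QuadraticForms.

(** * Zero bias and the Riccati kernels *)

Section LinearSystems.
Variables (R : realType) (k q s : nat) (D : 'M[R]_(k, s)) (C : 'M[R]_(k, q)).
Let F := 1%:M - D^† *m D.

Lemma mulmx_ker_proj : D *m F = 0.
Proof. by have [DXD _ _ _] := mpinvP D; rewrite mulmxBr mulmx1 mulmxA DXD subrr. Qed.

Lemma solution_param x (e : 'cV[R]_s) : D *m e = - (C *m x) ->
  e = F *m (e + D^† *m C *m x) - D^† *m C *m x.
Proof.
move=> De; have [_ XDX _ _] := mpinvP D.
have XD0 : D^† *m (D *m (e + D^† *m C *m x)) = 0.
  by rewrite mulmxDr De mulmxDr mulmxN !mulmxA XDX addNr.
by rewrite mulmxBl mul1mx -[D^† *m D *m _]mulmxA XD0 subr0 addrK.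
Qed.

Lemma solution_sat x (g : 'cV[R]_s) : (exists e0, D *m e0 = - (C *m x)) ->
  D *m (F *m g - D^† *m C *m x) = - (C *m x).
Proof.
move=> [e0 De0]; have [DXD _ _ _] := mpinvP D.
rewrite mulmxBr mulmxA mulmx_ker_proj mul0mx sub0r -mulmxA -[C *m x]opprK -De0.
by rewrite !mulmxN !mulmxA DXD.
Qed.
End LinearSystems.

(** Two forms are added by stacking their arguments; this turns one step of the
    Riccati recursion for the bias into a Schur complement. *)
Lemma schur_stacked (R : realType) (a p b s : nat) (P : 'M[R]_a) (W : 'M[R]_p)
    (A : 'M[R]_(a, b)) (B : 'M[R]_(a, s)) (C : 'M[R]_(p, b)) (D : 'M[R]_(p, s)) :
  P^T = P -> W^T = W ->
  schur (block_mx P 0 0 W) (col_mx A C) (col_mx B D) =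
  let M := D^T *m W *m C + B^T *m P *m A in
  A^T *m P *m A + C^T *m W *m C
    - M^T *m (D^T *m W *m D + B^T *m P *m B)^† *m M.
Proof.
move=> symP symW; rewrite /schur /= !tr_col_mx !mul_row_block.
rewrite !mulmx0 !addr0 !add0r !mul_row_col.
rewrite trmxD !trmx_mul !trmxK symP symW !mulmxA.
rewrite [B^T *m P *m B + _]addrC [B^T *m P *m A + _]addrC.
by rewrite [A^T *m P *m B + _]addrC.
Qed.

Section Plant.
Context (R : realType) (n m p s : nat) (S : plant R n m p s).
Hypotheses (psdP : possemidef (covP S)) (pdv : posdef (covv S)).

Lemma posdef_covnu : posdef (covnu S).
Proof.
have [symv v_gt0] := pdv; have := possemidef_conj (matC S)^T psdP.
rewrite trmxK => -[symC C_ge0]; split=> [|x x0]; first by rewrite trmxD symC symv.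
by rewrite qform_addmx ltr_wpDl // v_gt0.
Qed.

Lemma mpinv_unit k (M : 'M[R]_k) : M \in unitmx -> M^† = invmx M.
Proof.
move=> uM; have [MXM _ _ _] := mpinvP M.
by rewrite -[LHS](mulmxK uM) -[_ *m M](mulKmx uM) [M *m (_ *m M)]mulmxA MXM
  mulVmx // mul1mx.
Qed.

(** The filtered covariance is a Schur complement of the block diagonal matrix of
    P and the measurement covariance: x^T Phat x is the minimum over f of
    (x - C^T f)^T P (x - C^T f) + f^T covv f. *)
Lemma possemidef_covPhat : possemidef (covPhat S).
Proof.
pose Y : 'M[R]_(n + p, n) := col_mx 1%:M 0.
pose G : 'M[R]_(n + p, p) := col_mx (- (matC S)^T) 1%:M.
have psdB := possemidef_block psdP (posdef_semidef pdv).
suff -> : covPhat S = schur (block_mx (covP S) 0 0 (covv S)) Y G.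
  exact: possemidef_schur.
rewrite /schur.
have -> : G^T *m block_mx (covP S) 0 0 (covv S) *m G = covnu S.
  rewrite /G tr_col_mx mul_row_block !mulmx0 addr0 add0r mul_row_col.
  by rewrite trmxN trmxK trmx1 mul1mx mulmx1 mulNmx mulNmx mulmxN opprK.
rewrite (mpinv_unit (posdef_unit posdef_covnu)).
rewrite /Y /G !tr_col_mx trmx1 trmx0 !mul_row_block !mulmx0 !mul0mx !addr0 !add0r.
rewrite !mul_row_col mul1mx !mulmx1 !mul0mx !mulmx0 !addr0 trmxN trmxK.
by rewrite mulmxN !mulNmx mulmxN opprK /covPhat !mulmxA.
Qed.

Local Notation Si := (invmx (covnu S)).

Lemma riccPhatS k :
  riccPhat S k.+1 = schur (block_mx (riccPhat S k) 0 0 Si)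
    (col_mx (Ahat S) (Chat S)) (col_mx (Bhat S) (Dhat S)) /\
  possemidef (riccPhat S k).
Proof.
have [symI _] := posdef_inv posdef_covnu.
have step k' : possemidef (riccPhat S k') ->
    riccPhat S k'.+1 = schur (block_mx (riccPhat S k') 0 0 Si)
      (col_mx (Ahat S) (Chat S)) (col_mx (Bhat S) (Dhat S)).
  by move=> [symk _]; rewrite schur_stacked.
have psd : possemidef (riccPhat S k).
  elim: k => [|k' psdk]; first exact: possemidef0.
  rewrite step //; apply: possemidef_schur; apply: possemidef_block => //.
  exact/posdef_semidef/posdef_inv/posdef_covnu.
by split=> //; exact: step.
Qed.

Lemma possemidef_riccPhat k : possemidef (riccPhat S k).
Proof. by have [] := riccPhatS k. Qed.

(** The attack e produces no bias now, and leaves a state from which the bias can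
    be kept at zero for k more steps. *)
Definition silent k (th : 'cV[R]_(n + (n + n))) e :=
  riccPhat S k *m (Ahat S *m th + Bhat S *m e) = 0 /\
  Chat S *m th + Dhat S *m e = 0.

(** The form of riccPhat k.+1 is the minimum over e of the energy of the present
    bias plus the form of riccPhat k at the next state.  A minimum of
    nonnegative terms is zero exactly when some e makes all terms zero. *)
Lemma riccPhat_kerP k th :
  riccPhat S k.+1 *m th = 0 <-> exists e, silent k th e.
Proof.
have [eqS psdk] := riccPhatS k.
have psdI := posdef_semidef (posdef_inv posdef_covnu).
have psdB := possemidef_block psdk psdI.
have colE e : col_mx (Ahat S) (Chat S) *m th + col_mx (Bhat S) (Dhat S) *m e =
    col_mx (Ahat S *m th + Bhat S *m e) (Chat S *m th + Dhat S *m e).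
  by rewrite !mul_col_mx add_col_mx.
split=> [ker|[e [Pe Ce]]].
  exists (minimizer (block_mx (riccPhat S k) 0 0 Si) (col_mx (Ahat S) (Chat S))
     (col_mx (Bhat S) (Dhat S)) th).
  set e := minimizer _ _ _ _.
  have := qform_schur_min (col_mx (Ahat S) (Chat S)) (col_mx (Bhat S) (Dhat S)) psdB th.
  rewrite -eqS -/e colE qform_block.
  rewrite /(qform (riccPhat S k.+1)) -mulmxA ker mulmx0 [RHS]mxE => /eqP.
  rewrite paddr_eq0; [|by case: psdk|by case: psdI].
  move=> /andP[/eqP qP /eqP qC]; split; first exact: possemidef_ker.
  apply/eqP/negPn/negP => /(proj2 (posdef_inv posdef_covnu)).
  by rewrite qC ltxx.
have q0 : qform (riccPhat S k.+1) th = 0.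
  apply/eqP; rewrite eq_le; have [_ ->] := possemidef_riccPhat k.+1; rewrite andbT.
  have := qform_schur_le (col_mx (Ahat S) (Chat S)) (col_mx (Bhat S) (Dhat S)) psdB th e.
  by rewrite -eqS colE qform_block (qform_ker Pe) Ce qform0 addr0.
by apply: possemidef_ker => //; exact: possemidef_riccPhat.
Qed.

End Plant.

(** * The Bellman inequality *)

Section Bellman.
Context (R : realType) (n m p s : nat) (S : plant R n m p s).
Variables (N : nat) (Q : nat -> 'M[R]_n).

Local Notation xiT := ('cV[R]_(dimxi n)).

Lemma calG_calA : calG R n *m calA S = Ahat S *m calG R n.
Proof.
rewrite /calG /calA !mul_row_col !mul0mx !mul1mx !add0r !addr0.
by rewrite !mul_mx_row !mulmx0 mulmx1 !row_mx0.
Qed.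

Lemma Ctilde_calG : Ctilde S = Chat S *m calG R n.
Proof. by rewrite /calG !mul_mx_row !mulmx0 mulmx1. Qed.

Lemma col_mx_eq0 a b c (M : 'M[R]_(a, c)) (L : 'M[R]_(b, c)) :
  col_mx M L = 0 <-> M = 0 /\ L = 0.
Proof. by rewrite -[0]vsubmxK !linear0; split=> [/eq_col_mx|[-> ->]]. Qed.

(** The matrices of the law have fewer rows at the last step, where no future bias
    has to be prevented.  In both cases they come from one linear equation
    that says the same as [silent], since riccPhat 0 = 0. *)
Lemma calDC_calF t : (t <= N)%N ->
  exists k (D : 'M[R]_(k, s)) (C : 'M[R]_(k, dimxi n)),
    [/\ calDC S N t = D^† *m C, calF S N t = 1%:M - D^† *m D &
     forall xi e, silent S (N - t) (calG R n *m xi) e <-> D *m e = - (C *m xi)].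
Proof.
move=> tN; rewrite /calDC /calF; case: ifPn => [_|].
  exists _, (calD S N t), (calC S N t); split=> // xi e.
  rewrite (rwP eqP) -addr_eq0 -(rwP eqP) !mul_col_mx add_col_mx col_mx_eq0.
  rewrite -[_ *m calA S]mulmxA calG_calA Ctilde_calG /silent mulmxDr !mulmxA.
  by rewrite addrC [Dtilde S *m e + _]addrC.
rewrite -leqNgt => Nt; have -> : (N - t = 0)%N by apply/eqP.
exists _, (Dtilde S), (Ctilde S); split=> // xi e.
rewrite (rwP eqP) -addr_eq0 -(rwP eqP) Ctilde_calG /silent mul0mx -mulmxA.
by rewrite addrC; split=> [[]|].
Qed.

(** The free part of the attack is itself a preimage under calF, because that matrix
    is the projection on the kernel of D_t. *)
Lemma silent_param t xi e : (t <= N)%N -> silent S (N - t) (calG R n *m xi) e ->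
  e = calF S N t *m (e + calDC S N t *m xi) - calDC S N t *m xi.
Proof.
by move=> /calDC_calF[k [D [C [-> -> sP]]]] /sP; exact: solution_param.
Qed.

Lemma silent_sat t (xi : xiT) g : (t <= N)%N ->
  (exists e, silent S (N - t) (calG R n *m xi) e) ->
  silent S (N - t) (calG R n *m xi) (calF S N t *m g - calDC S N t *m xi).
Proof.
move=> /calDC_calF[k [D [C [-> -> sP]]]] [e /sP De].
by apply/sP; apply: solution_sat; exists e.
Qed.

Lemma riccQE t : (t <= N)%N ->
  riccQ S N Q t = (calH R n)^T *m Q t *m calH R n +
    schur (riccQ S N Q t.+1) (calAcl S N t) (calB S *m calF S N t).
Proof.
move=> tN; rewrite /riccQ subSS subSn // [LHS]/= subKn //.
rewrite -addrA; congr (_ + _); rewrite /schur; congr (_ - _).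
by rewrite !trmx_mul !mulmxA.
Qed.

Hypothesis psdQ : forall t, (t <= N)%N -> possemidef (Q t).

Lemma possemidef_riccQ t : (t <= N.+1)%N -> possemidef (riccQ S N Q t).
Proof.
move=> tN; rewrite -(subKn tN); move: (N.+1 - t)%N (leq_subr t N.+1) => k.
elim: k => [|k IH] kN; first by rewrite subn0 /riccQ subnn; exact: possemidef0.
rewrite subSS riccQE ?leq_subr //; apply: possemidefD.
  by apply: possemidef_conj; apply: psdQ; exact: leq_subr.
by apply: possemidef_schur; rewrite -subSn //; apply: IH; exact: ltnW.
Qed.

Definition stage t (xi : xiT) : R := qform (Q t) (calH R n *m xi).
Definition value t (xi : xiT) : R := qform (riccQ S N Q t) xi.

Lemma closed_loop t (xi : xiT) g :
  calA S *m xi + calB S *m (calF S N t *m g - calDC S N t *m xi) =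
  calAcl S N t *m xi + calB S *m calF S N t *m g.
Proof. by rewrite /calAcl mulmxBl mulmxBr !mulmxA addrA addrAC. Qed.

(** The constraint is used only to write e in the parametrized form; the bound is
    then the minimization over the free parameter. *)
Lemma bellman_le t (xi : xiT) e : (t <= N)%N -> silent S (N - t) (calG R n *m xi) e ->
  value t xi <= stage t xi + value t.+1 (calA S *m xi + calB S *m e).
Proof.
move=> tN se; rewrite (silent_param tN se) closed_loop /value riccQE //.
rewrite qform_addmx /stage qform_mulmx lerD2l qform_schur_le //.
exact: possemidef_riccQ.
Qed.

Lemma attack_lawE t xi :
  attack_law S N Q t xi = calF S N t *m
    minimizer (riccQ S N Q t.+1) (calAcl S N t) (calB S *m calF S N t) xi
  - calDC S N t *m xi.
Proof.
by rewrite /attack_law /minimizer mulmxN !trmx_mul /calAcl !mulmxA.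
Qed.

Lemma bellman_eq t (xi : xiT) : (t <= N)%N ->
  value t xi = stage t xi +
    value t.+1 (calA S *m xi + calB S *m attack_law S N Q t xi).
Proof.
move=> tN; rewrite attack_lawE closed_loop /value qform_schur_min.
  by rewrite riccQE // qform_addmx /stage qform_mulmx.
exact: possemidef_riccQ.
Qed.

End Bellman.

(** * The trajectory as the unattacked one plus a bias *)

(* Products of matrices become variables, so that [ring] only has to compare
   sums and differences of entries. *)
Ltac mx_abel :=
  repeat match goal with |- context [?M *m ?M'] =>
    let X := fresh "X" in move: (M *m M') => X end;
  apply/matrixP => ? ?; rewrite !mxE; ring.

Section BiasMaps.
Context (R : realType) (n m p s : nat) (S : plant R n m p s).
Local Notation A := (matA S).
Local Notation B := (matB S).
Local Notation C := (matC S).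
Local Notation Gamma := (matGamma S).
Local Notation Psi := (matPsi S).
Local Notation L := (gainL S).
Local Notation K := (gainK S).

(** The deviations of the state and of the prediction from their unattacked values
    are linear in theta = (t1, t2, t3).  Here t1 is the deviation of the previous
    estimate: it moves the state through the input B L and the prediction
    through A + B L.  The sum t2 + t3 is the part of the deviation of the state
    that is not due to this last input. *)
Definition state_bias : 'M[R]_(n, n + (n + n)) := row_mx (B *m L) (row_mx 1%:M 1%:M).
Definition prediction_bias : 'M[R]_(n, n + (n + n)) := row_mx (A + B *m L) (row_mx 0 0).

Lemma state_bias_Ahat : state_bias *m Ahat S = A *m state_bias + B *m L *m Omega S.
Proof.
rewrite /state_bias /Ahat mul_row_col mul_row_col !mul1mx !add_row_mx.
rewrite !addr0 !add0r [RHS]addrC; congr (_ + _).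
by rewrite !mul_mx_row !mulmx1 mulmxA.
Qed.

Lemma state_bias_Bhat : state_bias *m Bhat S = Gamma + B *m L *m K *m Psi.
Proof.
by rewrite /state_bias /Bhat !mul_row_col mulmx0 mul1mx add0r addrC !mulmxA.
Qed.

Lemma prediction_bias_Ahat : prediction_bias *m Ahat S = (A + B *m L) *m Omega S.
Proof.
by rewrite /prediction_bias /Ahat mul_row_col row_mx0 mul0mx addr0.
Qed.

Lemma prediction_bias_Bhat : prediction_bias *m Bhat S = (A + B *m L) *m K *m Psi.
Proof.
by rewrite /prediction_bias /Bhat mul_row_col row_mx0 mul0mx addr0 mulmxA.
Qed.

Lemma innovation_bias : C *m state_bias - C *m prediction_bias = Chat S.
Proof.
rewrite -mulmxBr /state_bias /prediction_bias opp_row_mx add_row_mx.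
rewrite opp_row_mx add_row_mx !subr0 opprD addrCA subrr addr0.
by rewrite !mul_mx_row !mulmx1 mulmxN.
Qed.

Lemma estimate_bias : prediction_bias + K *m Chat S = Omega S.
Proof.
rewrite /prediction_bias /Chat !mul_mx_row !add_row_mx !add0r /Omega.
by congr row_mx; rewrite mulmxBl mul1mx mulmxN mulmxA addrAC.
Qed.

End BiasMaps.

Section Trajectory.
Context (R : realType) (n m p s : nat) (S : plant R n m p s).
Context (d : measure_display) (T : measurableType d) (W : disturbances R n p T).
Variable xstar : 'cV[R]_n.
Local Notation A := (matA S).
Local Notation B := (matB S).
Local Notation C := (matC S).
Local Notation L := (gainL S).
Local Notation K := (gainK S).
Local Notation e0 := (@no_attack R s d T).
Implicit Types (e : nat -> T -> 'cV[R]_s).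

(** The noise and the unattacked trajectory cancel in the differences, which
    therefore follow the recursion of theta. *)
Lemma loop_theta e t w :
  state S W e t w = state S W e0 t w + state_bias S *m theta S e t w /\
  prediction S W e t w = prediction S W e0 t w + prediction_bias S *m theta S e t w.
Proof.
elim: t => [|t [IHx IHp]]; first by rewrite /state /prediction /= !mulmx0 !addr0.
have stateS e' : state S W e' t.+1 w = A *m state S W e' t w
    + B *m (L *m estimate S W e' t w) + matGamma S *m e' t w + noise_w W t w by [].
have predictionS e' : prediction S W e' t.+1 w =
    A *m estimate S W e' t w + B *m (L *m estimate S W e' t w) by [].
have thetaS : theta S e t.+1 w = Ahat S *m theta S e t w + Bhat S *m e t w by [].
have estimateE : estimate S W e t w = estimate S W e0 t w +
    (Omega S *m theta S e t w + K *m (matPsi S *m e t w)).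
  rewrite /estimate /innovation /output IHx IHp -estimate_bias -innovation_bias.
  rewrite /no_attack mulmx0 addr0 !(mulmxDl, mulmxDr, mulmxN, mulNmx) !mulmxA.
  by mx_abel.
rewrite !stateS !predictionS thetaS estimateE IHx !(mulmxDr _ (Ahat S *m _)).
rewrite !(mulmxA _ (Ahat S)) !(mulmxA _ (Bhat S)) state_bias_Ahat state_bias_Bhat.
rewrite prediction_bias_Ahat prediction_bias_Bhat /no_attack mulmx0.
by rewrite !(mulmxDl, mulmxDr) !mulmxA; split; mx_abel.
Qed.

Lemma bias_theta e t w : bias S W e t w = Chat S *m theta S e t w + Dhat S *m e t w.
Proof.
rewrite /bias /innovation /output; have [-> ->] := loop_theta e t w.
rewrite -innovation_bias /no_attack mulmx0 mulmxBl !mulmxDr !mulmxA /Dhat.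
by mx_abel.
Qed.

Definition correction t w : 'cV[R]_n := estimate S W e0 t w - prediction S W e0 t w.

Lemma prediction_succ t w :
  prediction S W e0 t.+1 w = (A + B *m L) *m estimate S W e0 t w.
Proof. by rewrite mulmxDl -!mulmxA. Qed.

(** The closed form of the augmented state xi: the conditional mean of x_t,
    which is determined only up to null sets, is replaced by the unattacked
    Kalman estimate shifted by the effect of the attack.  It makes the dynamics
    hold pointwise. *)
Definition kalman_xi e t w : 'cV[R]_(dimxi n) :=
  col_mx (estimate S W e0 t w + state_bias S *m theta S e t w)
    (col_mx (theta S e t w) (col_mx (estimate S W e0 t w) xstar)).

Definition noise_in : 'M[R]_(dimxi n, n) := col_mx 1%:M (col_mx 0 (col_mx 1%:M 0)).

(** The only randomness that enters after time t is the correction of the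
    unattacked filter; it acts on the conditional mean and on the unattacked
    estimate alike. *)
Lemma kalman_xiS e t w : kalman_xi e t.+1 w =
  (calA S *m kalman_xi e t w + calB S *m e t w) + noise_in *m correction t.+1 w.
Proof.
have hx : estimate S W e0 t.+1 w = (A + B *m L) *m estimate S W e0 t w + correction t.+1 w.
  by rewrite -prediction_succ /correction addrC subrK.
rewrite /kalman_xi /calA /calB /noise_in !mul_col_mx !add_col_mx !mul_row_col.
rewrite !mul0mx !mul1mx !addr0 !add0r; congr col_mx; last first.
  by rewrite hx /= /Bhat !mul_col_mx mul0mx.
rewrite hx /= mulmxDr !(mulmxA _ (Ahat S)) !(mulmxA _ (Bhat S)).
rewrite state_bias_Ahat state_bias_Bhat /Btilde !mulmxDr !mulmxDl !mulmxA.
by mx_abel.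
Qed.

End Trajectory.

(** * Gaussian and symmetric laws *)

Section NormalTail.
Variable R : realType.

(** A second moment of the normal density is controlled by a wider normal density,
    whose integral is known to be 1. *)
Lemma normal_pdf_tail (s : R) : 0 < s -> exists2 M : R, 0 <= M &
  forall x, (`|x| + 1) ^+ 2 * normal_pdf 0 s x <= M * normal_pdf 0 (2 * s) x.
Proof.
move=> s0; have s20 : 2 * s != 0 by rewrite mulf_neq0 ?gt_eqF.
have sn0 : s != 0 by rewrite gt_eqF.
pose K : R := 2 + 16 * s ^+ 2 / 3.
have K0 : 0 <= K by rewrite addr_ge0 // divr_ge0 // mulr_ge0 // sqr_ge0.
exists (K * normal_peak s / normal_peak (2 * s)).
  by rewrite divr_ge0 ?normal_peak_ge0 // mulr_ge0 ?normal_peak_ge0.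
move=> x; rewrite !normal_pdfE // [X in _ <= X]mulrA divfK ?gt_eqF ?normal_peak_gt0 //.
rewrite mulrCA [K * _]mulrC -[X in _ <= X]mulrA ler_wpM2l ?normal_peak_ge0 //.
rewrite /normal_fun !subr0.
(* - x^2 / (2 s^2) is split into the exponent of the density of deviation 2 s and
   a negative rest. *)
have -> : - x ^+ 2 / (s ^+ 2 *+ 2) =
    - (3 * x ^+ 2 / (8 * s ^+ 2)) + - x ^+ 2 / ((2 * s) ^+ 2 *+ 2).
  by field.
rewrite expRD mulrA ler_wpM2r ?expR_ge0 // expRN ler_pdivrMr ?expR_gt0 //.
apply: le_trans (ler_wpM2l K0 (expR_ge1Dx _)).
have -> : K * (1 + 3 * x ^+ 2 / (8 * s ^+ 2)) =
    2 + 2 * x ^+ 2 + 16 * s ^+ 2 / 3 + 3 * x ^+ 2 / (4 * s ^+ 2).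
  by rewrite /K; field.
have : 0 <= 16 * s ^+ 2 / 3 by rewrite divr_ge0 // mulr_ge0 // sqr_ge0.
have : 0 <= 3 * x ^+ 2 / (4 * s ^+ 2) by rewrite divr_ge0 // mulr_ge0 // sqr_ge0.
(* (|x| + 1)^2 is at most 2 x^2 + 2. *)
have := sqr_ge0 (`|x| - 1); rewrite -(real_normK (num_real x)).
by move: (`|x|) => y; rewrite sqrrB1 sqrrD1; lra.
Qed.
End NormalTail.

Section Laws.
Context (R : realType) (d : measure_display) (T : measurableType d).
Variable Pr : probability T R.

Definition shell (k : nat) : set R := (fun x => Num.truncn `|x|) @^-1` [set k].

Lemma shellP k x : shell k x <-> k%:R <= `|x| < k.+1%:R.
Proof.
split=> [<-|/truncn_def //]; exact: truncn_itv.
Qed.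

Lemma measurable_shell k : measurable (shell k).
Proof.
have -> : shell k = (fun x : R => `|x|) @^-1` `[k%:R, k.+1%:R[%classic.
  by apply/seteqP; split=> x; rewrite /= in_itv /= => /shellP.
by rewrite -[_ @^-1` _]setTI; exact: normr_measurable.
Qed.

Lemma bigcup_shell : \bigcup_k shell k = setT.
Proof. by apply/seteqP; split=> // x _; exists (Num.truncn `|x|). Qed.

Lemma trivIset_shell : trivIset setT shell.
Proof. exact: trivIset_preimage1. Qed.

(** The law of X is given only as a set function, so the second moment is bounded
    shell by shell: on the k-th shell X^2 is at most (k + 1)^2, and this constant
    times the density is at most the density of [normal_pdf_tail]. *)
Lemma normal_sqr_integrable (X : T -> R) (s : R) : 0 < s ->
  measurable_fun setT X ->
  (forall D, measurable D -> Pr (X @^-1` D) = normal_prob 0 s D) ->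
  Pr.-integrable setT (EFin \o (fun w => X w ^+ 2 : R)).
Proof.
move=> s0 mX lawX; have [M M0 tail] := normal_pdf_tail s0.
have mX2 : measurable_fun setT (EFin \o (fun w => X w ^+ 2 : R)).
  by apply/measurable_EFinP; exact: measurable_funX.
have mS k : measurable (X @^-1` shell k).
  by rewrite -[_ @^-1` _]setTI; apply: mX => //; exact: measurable_shell.
apply/integrableP; split=> //.
under eq_integral do rewrite gee0_abs ?lee_fin ?sqr_ge0 //.
have cover : \bigcup_k (X @^-1` shell k) = setT.
  by rewrite -preimage_bigcup bigcup_shell preimage_setT.
rewrite -cover ge0_integral_bigcup //; last 3 first.
- exact: measurable_funTS.
- by move=> w _; rewrite lee_fin sqr_ge0.
- exact: (@trivIset_preimage1 _ _ _ (fun w => Num.truncn `|X w|)).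
apply: (@le_lt_trans _ _ (\sum_(k <oo)
   \int[lebesgue_measure]_(x in shell k) (M%:E * (normal_pdf 0 (2 * s) x)%:E))%E).
  apply: lee_nneseries => [k _ _|k _].
    by apply: integral_ge0 => w _; rewrite lee_fin sqr_ge0.
  apply: (@le_trans _ _ (\int[Pr]_(w in X @^-1` shell k) ((k.+1%:R ^+ 2)%:E))%E).
    apply: ge0_le_integral => //.
    - by move=> w _; rewrite lee_fin sqr_ge0.
    - exact: measurable_funTS.
    - move=> w /shellP/andP[_ Xk]; rewrite lee_fin -(real_normK (num_real (X w))).
      by rewrite lerXn2r ?nnegrE // ltW.
  have -> : (\int[Pr]_(w in X @^-1` shell k) (k.+1%:R ^+ 2)%:E =
             (k.+1%:R ^+ 2)%:E * normal_prob 0 s (shell k))%E.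
    rewrite integral_cst //; congr (_ * _)%E.
    by apply: lawX; exact: measurable_shell.
  rewrite /normal_prob -ge0_integralZl_EFin ?sqr_ge0 //; last 3 first.
  - exact: measurable_shell.
  - by move=> x _; rewrite lee_fin normal_pdf_ge0.
  - by apply/measurable_funTS/measurable_EFinP; exact: measurable_normal_pdf.
  apply: ge0_le_integral; first exact: measurable_shell.
  - by move=> x _; rewrite -EFinM lee_fin mulr_ge0 ?sqr_ge0 ?normal_pdf_ge0.
  - apply/measurable_funTS/measurable_EFinP/measurable_funM => //.
    exact: measurable_normal_pdf.
  - apply/measurable_funTS/measurable_EFinP/measurable_funM => //.
    exact: measurable_normal_pdf.
  - move=> x /shellP/andP[xk _]; rewrite -!EFinM lee_fin.
    apply: le_trans (tail x); rewrite ler_wpM2r ?normal_pdf_ge0 //.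
    by rewrite lerXn2r ?nnegrE ?addr_ge0 // -natr1 lerD2r.
rewrite -ge0_integral_bigcup; last 4 first.
- exact: measurable_shell.
- apply/measurable_funTS/measurable_EFinP/measurable_funM => //.
  exact: measurable_normal_pdf.
- by move=> x _; rewrite -EFinM lee_fin mulr_ge0 ?normal_pdf_ge0.
- exact: trivIset_shell.
rewrite bigcup_shell ge0_integralZl_EFin //; last 2 first.
- by move=> x _; rewrite lee_fin normal_pdf_ge0.
- by apply/measurable_EFinP; exact: measurable_normal_pdf.
by rewrite integral_normal_pdf mule1 ltry.
Qed.

Lemma dirac_sqr_integrable (X : T -> R) : measurable_fun setT X ->
  (forall D, measurable D -> Pr (X @^-1` D) = \d_(0 : R) D) ->
  Pr.-integrable setT (EFin \o (fun w => X w ^+ 2 : R)).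
Proof.
move=> mX lawX; have mX2 : measurable_fun setT (EFin \o (fun w => X w ^+ 2 : R)).
  by apply/measurable_EFinP; exact: measurable_funX.
apply/integrableP; split=> //.
rewrite (ge0_ae_eq_integral (g := cst 0%E)) //.
- by rewrite integral0.
- exact: measurableT_comp.
have mD : measurable (~` [set 0 : R]) by apply: measurableC; exact: measurable_set1.
exists (X @^-1` (~` [set 0])); split.
- by rewrite -[_ @^-1` _]setTI; exact: mX.
- by have := lawX _ mD; rewrite diracE memNset //; exact.
- by move=> w /= /not_implyP[_ h] X0; apply: h; rewrite X0 expr0n /= normr0.
Qed.

Section Gaussian.
Variables (n : nat) (X : T -> 'cV[R]_n) (S : 'M[R]_n).
Hypothesis gaussX : gaussian Pr X S.

Lemma delta_coord (x : 'cV[R]_n) i : ((delta_mx i 0 : 'cV[R]_n)^T *m x) 0 0 = x i 0.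
Proof. by rewrite trmx_delta -rowE mxE. Qed.

Lemma gaussian_measurable i : measurable_fun setT (fun w => X w i 0).
Proof.
have [mX _] := gaussX (delta_mx i 0); apply: eq_measurable_fun mX => w _.
exact: delta_coord.
Qed.

(** The laws of a^T X and of (- a)^T X have the same variance. *)
Lemma gaussian_symmetric i D : measurable D ->
  Pr ((fun w => X w i 0) @^-1` D) = Pr ((fun w => - X w i 0) @^-1` D).
Proof.
move=> mD; have [_ /(_ D mD) law] := gaussX (delta_mx i 0).
have [_ /(_ D mD) lawN] := gaussX (- delta_mx i 0).
have qN : qform S (- delta_mx i 0) = qform S (delta_mx i 0).
  by rewrite /qform trmxN !mulNmx mulmxN opprK.
have -> : (fun w => X w i 0) @^-1` D = [set w | D (((delta_mx i 0 : 'cV[R]_n)^T *m X w) 0 0)].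
  by apply/seteqP; split=> w /=; rewrite delta_coord.
rewrite law -qN -lawN; congr (Pr _); apply/seteqP; split=> w /=;
  by rewrite trmxN mulNmx mxE delta_coord.
Qed.

Lemma gaussian_sqr_integrable i : possemidef S ->
  Pr.-integrable setT (EFin \o (fun w => X w i 0 ^+ 2 : R)).
Proof.
move=> [_ S_ge0]; have [_ law] := gaussX (delta_mx i 0).
have {}law D : measurable D ->
    Pr ((fun w => X w i 0) @^-1` D) = centered_normal (qform S (delta_mx i 0)) D.
  move=> mD; rewrite -law //; congr (Pr _).
  by apply/seteqP; split=> w /=; rewrite delta_coord.
have mXi := gaussian_measurable i; move: law; rewrite /centered_normal.
case: eqVneq => [_|v0] law; first exact: dirac_sqr_integrable.
by apply: normal_sqr_integrable law => //; rewrite sqrtr_gt0 lt0r v0 S_ge0.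
Qed.

End Gaussian.

(** By independence the pairs (X, Y) and (- X, Y) have the same product law, so the
    mean of X Y equals its own opposite. *)
Lemma symmetric_orthogonal (X Y : T -> R) :
  measurable_fun setT X -> measurable_fun setT Y ->
  (forall D, measurable D -> Pr (X @^-1` D) = Pr ((fun w => - X w) @^-1` D)) ->
  (forall D D', measurable D -> measurable D' ->
     Pr (X @^-1` D `&` Y @^-1` D') = (Pr (X @^-1` D) * Pr (Y @^-1` D'))%E) ->
  Pr.-integrable setT (EFin \o (fun w => X w * Y w : R)) ->
  (\int[Pr]_w (X w * Y w)%:E = 0)%E.
Proof.
move=> mX mY symX indepXY intXY.
pose X' : {RV Pr >-> R} := HB.pack X (isMeasurableFun.Build _ _ _ _ _ mX).
pose Y' : {RV Pr >-> R} := HB.pack Y (isMeasurableFun.Build _ _ _ _ _ mY).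
pose phi w := (X w, Y w); pose psi w := (- X w, Y w).
have mphi : measurable_fun setT phi by exact: measurable_fun_pair.
have mpsi : measurable_fun setT psi.
  by apply: measurable_fun_pair => //; exact: measurableT_comp.
pose phi' : {RV Pr >-> (R * R)%type} := HB.pack phi (isMeasurableFun.Build _ _ _ _ _ mphi).
pose psi' : {RV Pr >-> (R * R)%type} := HB.pack psi (isMeasurableFun.Build _ _ _ _ _ mpsi).
pose prod := (distribution Pr X' \x distribution Pr Y')%E.
have lawphi D : measurable D -> prod D = distribution Pr phi' D.
  apply: product_measure_unique => A B mA mB; exact: indepXY.
have lawpsi D : measurable D -> prod D = distribution Pr psi' D.
  apply: product_measure_unique => A B mA mB.
  have mA' : measurable ((fun x : R => - x) @^-1` A).
    by rewrite -[_ @^-1` _]setTI; exact: (@oppr_measurable R).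
  rewrite [LHS](indepXY _ _ mA' mB); congr (_ * _)%E.
  exact: (esym (symX _ mA)).
pose f (z : R * R) : \bar R := (z.1 * z.2)%:E.
have mf : measurable_fun setT f.
  apply/measurable_EFinP/measurable_funM; first exact: measurable_fst.
  exact: measurable_snd.
have Ephi : (\int[distribution Pr phi']_z f z = \int[Pr]_w (X w * Y w)%:E)%E.
  exact: integral_distribution.
have Epsi : (\int[distribution Pr psi']_z f z = - \int[Pr]_w (X w * Y w)%:E)%E.
  have negE : f \o psi' = -%E \o (EFin \o (fun w => X w * Y w : R)).
    by apply/funext => w; rewrite /= /f /= mulNr EFinN.
  rewrite integral_distribution // negE; last exact: integrableN.
  by rewrite [LHS]integralN //; exact: integrable_add_def.
have EE : (\int[Pr]_w (X w * Y w)%:E = - \int[Pr]_w (X w * Y w)%:E)%E.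
  rewrite -{1}Ephi -Epsi; apply: eq_measure_integral => A mA _.
  exact: (etrans (esym (lawphi _ mA)) (lawpsi _ mA)).
have : (\int[Pr]_w (X w * Y w)%:E)%E \is a fin_num by exact: integrable_fin_num.
move: EE; case: (\int[Pr]_w _)%E => // r [rE] _; congr EFin.
by lra.
Qed.

End Laws.

(** * Measurability and conditional expectation *)

Section VectorMeasurability.
Context (R : realType) (d : measure_display) (T : measurableType d).

Definition measurable_vec n (X : T -> 'cV[R]_n) :=
  forall i, measurable_fun setT (fun w => X w i 0).

Lemma measurable_vec_cst n (x : 'cV[R]_n) : measurable_vec (fun _ => x).
Proof. by move=> i; exact: measurable_cst. Qed.

Lemma measurable_vecD n (X Y : T -> 'cV[R]_n) :
  measurable_vec X -> measurable_vec Y -> measurable_vec (fun w => X w + Y w).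
Proof.
move=> mX mY i; under eq_fun do rewrite mxE.
exact: measurable_funD.
Qed.

Lemma measurable_vec_mulmx n k (M : 'M[R]_(k, n)) (X : T -> 'cV[R]_n) :
  measurable_vec X -> measurable_vec (fun w => M *m X w).
Proof.
move=> mX i; under eq_fun do rewrite mxE.
by apply: measurable_sum => j; apply: measurable_funM => //; exact: measurable_cst.
Qed.

Lemma measurable_vecN n (X : T -> 'cV[R]_n) :
  measurable_vec X -> measurable_vec (fun w => - X w).
Proof.
move=> mX; have -> : (fun w => - X w) = (fun w => - 1%:M *m X w).
  by apply/funext => w; rewrite mulNmx mul1mx.
exact: measurable_vec_mulmx.
Qed.

Lemma measurable_vecB n (X Y : T -> 'cV[R]_n) :
  measurable_vec X -> measurable_vec Y -> measurable_vec (fun w => X w - Y w).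
Proof. by move=> mX mY; apply: measurable_vecD => //; exact: measurable_vecN. Qed.

Lemma measurable_vec_col n k (X : T -> 'cV[R]_n) (Y : T -> 'cV[R]_k) :
  measurable_vec X -> measurable_vec Y -> measurable_vec (fun w => col_mx (X w) (Y w)).
Proof.
move=> mX mY i; case: (splitP i) => [j ij|j ij].
  have -> : i = lshift k j by exact: val_inj.
  by under eq_fun do rewrite col_mxEu; exact: mX.
have -> : i = rshift n j by exact: val_inj.
by under eq_fun do rewrite col_mxEd; exact: mY.
Qed.

Lemma measurable_vec_qform n (S : 'M[R]_n) (X : T -> 'cV[R]_n) : measurable_vec X ->
  measurable_fun setT (fun w => qform S (X w)).
Proof.
move=> mX; rewrite /qform.
under eq_fun do rewrite -mulmxA mxE.
apply: measurable_sum => j; apply: measurable_funM; last exact: measurable_vec_mulmx.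
by under eq_fun do rewrite mxE; exact: mX.
Qed.

End VectorMeasurability.

Section GeneratedSigmaAlgebras.
Context (R : realType) (d : measure_display) (T : measurableType d).
Implicit Type G : set (set T).

(** Measurability with respect to the sigma-algebra generated by G is
    measurability for the measurable space that G generates, so that the closure
    properties of measurable functions apply. *)
Definition adapted G (f : T -> R) :=
  @measurable_fun _ _ (g_sigma_algebraType G) R setT f.
Definition adapted_vec G n (X : T -> 'cV[R]_n) :=
  @measurable_vec R _ (g_sigma_algebraType G) n X.

Lemma adaptedP G f : adapted G f <-> forall D, measurable D -> <<s G>> [set w | D (f w)].
Proof.
split=> [mf D mD|mf _ D mD]; first by have := mf measurableT D mD; rewrite setTI.
by rewrite setTI; exact: mf.
Qed.

Lemma adapted_vecP G n (X : T -> 'cV[R]_n) : adapted_vec G X <-> vec_events X `<=` <<s G>>.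
Proof.
split=> [mX _ [i [D [mD ->]]]|sX i]; first exact: ((adaptedP _ _).1 (mX i)).
by apply/adaptedP => D mD; apply: sX; exists i, D.
Qed.

Lemma adapted_sub G G' f : <<s G>> `<=` <<s G'>> -> adapted G f -> adapted G' f.
Proof. by move=> sG /adaptedP mf; apply/adaptedP => D mD; apply: sG; exact: mf. Qed.

Lemma adapted_vec_sub G G' n (X : T -> 'cV[R]_n) :
  <<s G>> `<=` <<s G'>> -> adapted_vec G X -> adapted_vec G' X.
Proof. by move=> sG mX i; apply: adapted_sub sG _; exact: mX. Qed.

Lemma adapted_vec_gen G n (X : T -> 'cV[R]_n) : vec_events X `<=` G -> adapted_vec G X.
Proof. by move=> sX; apply/adapted_vecP => E /sX; exact: sub_gen_smallest. Qed.

Lemma gen_sub G G' : G `<=` <<s G'>> -> <<s G>> `<=` <<s G'>>.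
Proof. by apply: smallest_sub; exact: smallest_sigma_algebra. Qed.

Lemma gen_measurable G : G `<=` measurable -> <<s G>> `<=` measurable.
Proof. by apply: smallest_sub; exact: sigma_algebra_measurable. Qed.

Lemma adapted_measurable G f : <<s G>> `<=` measurable -> adapted G f -> measurable_fun setT f.
Proof.
move=> sG /adaptedP mf _ D mD; rewrite setTI; apply: sG; exact: mf.
Qed.

Lemma adapted_vec_measurable G n (X : T -> 'cV[R]_n) :
  <<s G>> `<=` measurable -> adapted_vec G X -> measurable_vec X.
Proof. by move=> sG mX i; apply: adapted_measurable sG _; exact: mX. Qed.

Lemma vec_events_measurable n (X : T -> 'cV[R]_n) :
  measurable_vec X -> vec_events X `<=` measurable.
Proof.
move=> mX _ [i [D [mD ->]]]; rewrite -[X in measurable X]setTI; exact: mX.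
Qed.

End GeneratedSigmaAlgebras.

Section ConditionalExpectation.
Context (R : realType) (d : measure_display) (T : measurableType d).
Variables (Pr : probability T R) (G : set (set T)).
Hypothesis sG : <<s G>> `<=` measurable.

Lemma bounded_integrable (f : T -> R) (M : R) E : measurable E ->
  measurable_fun setT f -> (forall w, E w -> `|f w| <= M) ->
  Pr.-integrable E (EFin \o f).
Proof.
move=> mE mf fM; apply: (le_integrable mE (g := cst M%:E)).
- by apply/measurable_funTS/measurable_EFinP.
- by move=> w Ew /=; rewrite lee_fin (le_trans (fM w Ew)) // ler_norm.
- exact: finite_measure_integrable_cst.
Qed.

(** On the events where Z < Z', both versions are at most j in absolute value and X
    is integrable, both have the same integral as X; hence these events are
    negligible, and countably many of them cover the event Z < Z'. *)
Lemma is_condE_ltN (X Z Z' : T -> R) :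
  is_condE Pr <<s G>> X Z -> is_condE Pr <<s G>> X Z' ->
  {ae Pr, forall w, ~ (Z w < Z' w)}.
Proof.
move=> [/adaptedP mZ [F [GF coverF intF]] avZ] [/adaptedP mZ' _ avZ'].
pose E k j := F k `&` (Z @^-1` `[- j%:R, j%:R] `&` Z' @^-1` `[- j%:R, j%:R]
  `&` (fun w => Z w - Z' w) @^-1` `]-oo, 0[).
have GE k j : <<s G>> (E k j).
  have pre (f : T -> R) (I : interval R) : adapted G f -> <<s G>> (f @^-1` [set` I]).
    by move=> /adaptedP mf; exact: mf.
  have capG A B : <<s G>> A -> <<s G>> B -> <<s G>> (A `&` B).
    exact: (@measurableI _ (g_sigma_algebraType G)).
  apply: (capG) => //; apply: (capG); first by apply: (capG); exact: pre.
  by apply: pre; exact: (@measurable_funB _ (g_sigma_algebraType G)).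
have mTZ := adapted_measurable sG mZ; have mTZ' := adapted_measurable sG mZ'.
have EP k j w : E k j w -> [/\ F k w, `|Z w| <= j%:R, `|Z' w| <= j%:R & Z w < Z' w].
  move=> [Fw [[/= + +] /=]]; rewrite !in_itv /= => Zw Z'w ltw.
  by split=> //; rewrite ?ler_norml // -subr_lt0.
have key k j : {ae Pr, forall w, ~ E k j w}.
  have mE : measurable (E k j) by apply: sG.
  have intE (f : T -> R) : measurable_fun setT f -> (forall w, E k j w -> `|f w| <= j%:R) ->
    Pr.-integrable (E k j) (EFin \o f) by exact: bounded_integrable.
  have iZ : Pr.-integrable (E k j) (EFin \o Z) by apply: intE => // w /EP[].
  have iZ' : Pr.-integrable (E k j) (EFin \o Z') by apply: intE => // w /EP[].
  have iX : Pr.-integrable (E k j) (EFin \o X).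
    by apply: integrableS (intF k) => //; [by apply: sG; exact: GF|move=> w /EP[]].
  have zero : (\int[Pr]_(w in E k j) `|(Z' w - Z w)%:E| = 0)%E.
    under eq_integral => w.
      rewrite inE => /EP[_ _ _ lt_w]; rewrite gee0_abs ?lee_fin ?subr_ge0 ?ltW // EFinB.
    over.
    by rewrite integralB_EFin // -avZ // -avZ' // subee // integrable_fin_num.
  have mD : measurable_fun (E k j) (EFin \o (fun w => Z' w - Z w)).
    by apply/measurable_funTS/measurable_EFinP/measurable_funB.
  have := (ae_eq_integral_abs Pr mE mD).1 zero.
  apply: filterS => w h Ew; have [_ _ _] := EP _ _ _ Ew.
  by have /= [] := h Ew => /eqP; rewrite subr_eq0 => /eqP ->; rewrite ltxx.
have := ae_foralln (fun k => ae_foralln (key k)).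
apply: filterS => w h lt_w.
have [k _ Fk] : (\bigcup_k F k) w by rewrite coverF.
apply: (h k (Num.truncn (`|Z w| + `|Z' w|)).+1).
have lt_t := truncnS_gt (`|Z w| + `|Z' w|).
split=> //; split; first split; rewrite /= in_itv /= ?subr_lt0 // -ler_norml.
  by apply: le_trans (ltW lt_t); rewrite lerDl.
by apply: le_trans (ltW lt_t); rewrite lerDr.
Qed.

Lemma is_condE_unique (X Z Z' : T -> R) :
  is_condE Pr <<s G>> X Z -> is_condE Pr <<s G>> X Z' -> {ae Pr, forall w, Z w = Z' w}.
Proof.
move=> cZ cZ'; have := is_condE_ltN cZ cZ'; have := is_condE_ltN cZ' cZ.
by apply: filterS2 => w /negP h /negP h'; apply/eqP; rewrite eq_le !leNgt h h'.
Qed.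

Lemma condE_version (X Z : T -> R) : is_condE Pr <<s G>> X Z ->
  {ae Pr, forall w, condE Pr <<s G>> X w = Z w}.
Proof.
move=> cZ; apply: is_condE_unique (cZ).
exact: (xgetI (P := [set Z | is_condE Pr <<s G>> X Z]) _ cZ).
Qed.

(** This holds whether or not the conditional expectation exists, because the
    default value is a constant. *)
Lemma condE_measurable (X : T -> R) : adapted G (condE Pr <<s G>> X).
Proof.
rewrite /condE; case: xgetP => [Z _ [mZ _ _]|_]; first exact/adaptedP.
exact: measurable_cst.
Qed.

(** X need not be integrable: it is the sum of an integrable error and of Z, which
    is bounded on the sets where its absolute value is at most k. *)
Lemma is_condE_shift (X Z : T -> R) : adapted G Z ->
  Pr.-integrable setT (EFin \o (fun w => X w - Z w)) ->
  (forall E, <<s G>> E -> \int[Pr]_(w in E) (X w - Z w)%:E = 0)%E ->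
  is_condE Pr <<s G>> X Z.
Proof.
move=> mZ intD zero; have mTZ := adapted_measurable sG mZ.
have intDE E : <<s G>> E -> Pr.-integrable E (EFin \o (fun w => X w - Z w)).
  by move=> GE; apply: integrableS intD => //; exact: sG.
split; first exact/adaptedP.
  exists (fun k => Z @^-1` `[- k%:R, k%:R]).
  have GF k : <<s G>> (Z @^-1` `[- k%:R, k%:R]) by apply: (adaptedP _ _).1.
  split=> // [|k].
    apply/seteqP; split=> // w _; exists (Num.truncn `|Z w|).+1 => //=.
    by rewrite in_itv /= -ler_norml ltW // truncnS_gt.
  have -> : X = fun w => (X w - Z w) + Z w by apply/funext => w; rewrite subrK.
  apply: (@integrableD _ _ _ _ _ _ (EFin \o (fun w => X w - Z w)) (EFin \o Z)).
  - exact: sG.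
  - exact: intDE.
  - apply: (bounded_integrable (M := k%:R)) => //; first exact: sG.
    by move=> w /=; rewrite in_itv /= ler_norml.
move=> E GE intX; have intZ : Pr.-integrable E (EFin \o Z).
  have -> : Z = fun w => X w - (X w - Z w) by apply/funext => w; rewrite subKr.
  apply: (@integrableB _ _ _ _ _ _ (EFin \o X) (EFin \o (fun w => X w - Z w))) => //.
    exact: sG.
  exact: intDE.
have := zero E GE; under eq_integral do rewrite EFinB.
rewrite integralB_EFin //; last exact: sG.
move=> /eqP; rewrite sube_eq ?add0e => [/eqP //||].
  exact: (integrable_fin_num (sG GE) intX).
exact: fin_num_adde_defr.
Qed.

End ConditionalExpectation.

(** * Gaussian vectors independent of a sigma-algebra *)

Section GaussianIndependent.
Context (R : realType) (d : measure_display) (T : measurableType d).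
Variables (Pr : probability T R) (n : nat) (X : T -> 'cV[R]_n) (S : 'M[R]_n).
Variable G : set (set T).
Hypotheses (gaussX : gaussian Pr X S) (sG : <<s G>> `<=` measurable).
Hypothesis indepXG : independent Pr <<s vec_events X>> <<s G>>.

Lemma gaussian_measurable_vec : measurable_vec X.
Proof. by move=> i; exact: gaussian_measurable gaussX i. Qed.

(** Only products with adapted variables are needed, so the symmetry of the law
    replaces any computation of moments. *)
Lemma gaussian_orthogonal i (Y : T -> R) : adapted G Y ->
  Pr.-integrable setT (EFin \o (fun w => X w i 0 * Y w : R)) ->
  (\int[Pr]_w (X w i 0 * Y w)%:E = 0)%E.
Proof.
move=> mY; apply: symmetric_orthogonal.
- exact: gaussian_measurable_vec.
- exact: adapted_measurable sG mY.
- by move=> D mD; rewrite (gaussian_symmetric gaussX).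
- move=> D D' mD mD'; apply: indepXG; last exact: (adaptedP _ _).1 mY D' mD'.
  by apply: sub_gen_smallest; exists i, D.
Qed.

Lemma gaussian_integrable i : possemidef S ->
  Pr.-integrable setT (EFin \o (fun w => X w i 0 : R)).
Proof.
move=> psdS; have int2 := gaussian_sqr_integrable gaussX i psdS.
have mXi := gaussian_measurable_vec i.
apply: (le_integrable _ (g := EFin \o (fun w => 1 + X w i 0 ^+ 2 : R))) => //.
- exact/measurable_EFinP.
- move=> w _ /=; rewrite lee_fin [leRHS]ger0_norm ?addr_ge0 ?sqr_ge0 //.
  have := sqr_ge0 (`|X w i 0| - 1); rewrite -(real_normK (num_real (X w i 0))).
  by have := normr_ge0 (X w i 0); move: (`|X w i 0|) => y; rewrite sqrrB1; nra.
- apply: (@integrableD _ _ _ _ _ _ (EFin \o cst 1)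
      (EFin \o (fun w => X w i 0 ^+ 2 : R))) => //.
  exact: finite_measure_integrable_cst.
Qed.

(** This is the orthogonality to the indicator of E. *)
Lemma gaussian_integral0 i E : possemidef S -> <<s G>> E ->
  (\int[Pr]_(w in E) (X w i 0)%:E = 0)%E.
Proof.
move=> psdS GE; have mE := sG GE.
rewrite integral_mkcond.
have -> : (fun w => (X w i 0)%:E) \_ E = (fun w => (X w i 0 * \1_E w)%:E).
  apply/funext => w; rewrite patchE indicE; case: ifP => _; by rewrite ?mulr1 ?mulr0.
apply: gaussian_orthogonal.
  by apply: (@measurable_indic _ (g_sigma_algebraType G)).
have mXi := gaussian_measurable_vec i.
apply: (le_integrable _ _ _ (gaussian_integrable i psdS)) => //.
  apply/measurable_EFinP/measurable_funM => //; exact: measurable_indic.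
move=> w _ /=; rewrite lee_fin normrM ler_piMr //.
by rewrite indicE; case: (_ \in _); rewrite ?normr1 ?normr0.
Qed.

End GaussianIndependent.

(** * What the attacker knows *)

Section Information.
Context (R : realType) (n m p s : nat) (S : plant R n m p s).
Context (d : measure_display) (T : measurableType d).
Variables (Pr : probability T R) (W : disturbances R n p T) (xstar : 'cV[R]_n).
Local Notation A := (matA S).
Local Notation B := (matB S).
Local Notation C := (matC S).
Local Notation L := (gainL S).
Local Notation K := (gainK S).
Local Notation e0 := (@no_attack R s d T).
Implicit Types (e : nat -> T -> 'cV[R]_s) (G : set (set T)).

Definition past_gens t : set (set T) :=
  (\bigcup_k vec_events (past_y W k))
      `|` (\bigcup_(k in [set k | (k < t)%N]) vec_events (output S W e0 k)).

Definition info_gens e t : set (set T) :=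
  (\bigcup_k vec_events (past_y W k))
      `|` (\bigcup_(k in [set k | (k <= t)%N]) vec_events (ytilde S W e k))
      `|` (\bigcup_(k in [set k | (k < t)%N]) vec_events (e k)).

Lemma prediction_adapted G t : adapted_vec G (init_pred W) ->
  (forall k, (k < t)%N -> adapted_vec G (output S W e0 k)) ->
  adapted_vec G (prediction S W e0 t).
Proof.
move=> mi; elim: t => [|t IH] mo; first exact: mi.
have -> : prediction S W e0 t.+1 = fun w => (A + B *m L) *m (prediction S W e0 t w
    + K *m (output S W e0 t w - C *m prediction S W e0 t w)).
  by apply/funext => w; exact: prediction_succ.
have mp : adapted_vec G (prediction S W e0 t) by apply: IH => k kt; apply: mo; exact: ltnW.
apply: measurable_vec_mulmx; apply: measurable_vecD => //.
apply: measurable_vec_mulmx; apply: measurable_vecB.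
  exact: mo.
exact: measurable_vec_mulmx.
Qed.

Lemma estimate_adapted G t : adapted_vec G (init_pred W) ->
  (forall k, (k <= t)%N -> adapted_vec G (output S W e0 k)) ->
  adapted_vec G (estimate S W e0 t).
Proof.
move=> mi mo; have mp : adapted_vec G (prediction S W e0 t).
  by apply: prediction_adapted => // k kt; apply: mo; exact: ltnW.
apply: measurable_vecD => //; apply: measurable_vec_mulmx.
apply: measurable_vecB; first exact: mo.
exact: measurable_vec_mulmx.
Qed.

Lemma theta_adapted G e t :
  (forall k, (k < t)%N -> adapted_vec G (e k)) -> adapted_vec G (theta S e t).
Proof.
elim: t => [|t IH] me; first exact: measurable_vec_cst.
apply: measurable_vecD; apply: measurable_vec_mulmx; last exact: me.
by apply: IH => k kt; apply: me; exact: ltnW.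
Qed.

Lemma ytilde_output e t w :
  ytilde S W e t w = output S W e0 t w + C *m state_bias S *m theta S e t w.
Proof.
rewrite /ytilde /output; have [-> _] := loop_theta S W e t w.
by rewrite /no_attack mulmx0 addr0 mulmxDr mulmxA addrAC.
Qed.

Lemma info_e e t k : (k < t)%N -> adapted_vec (info_gens e t) (e k).
Proof. by move=> kt; apply: adapted_vec_gen => E Ek; right; exists k. Qed.

Lemma info_theta e t k : (k <= t)%N -> adapted_vec (info_gens e t) (theta S e k).
Proof. by move=> kt; apply: theta_adapted => j jk; apply: info_e; exact: leq_trans kt. Qed.

(** The attacker knows his own attacks, so he can subtract their effect from the
    outputs that he measures. *)
Lemma info_output e t k : (k <= t)%N -> adapted_vec (info_gens e t) (output S W e0 k).
Proof.
move=> kt; have -> : output S W e0 k =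
    fun w => ytilde S W e k w - C *m state_bias S *m theta S e k w.
  by apply/funext => w; rewrite ytilde_output addrK.
apply: measurable_vecB; last by apply: measurable_vec_mulmx; exact: info_theta.
by apply: adapted_vec_gen => E Ek; left; right; exists k.
Qed.

Hypothesis init_past : vec_events (init_pred W) `<=` <<s \bigcup_k vec_events (past_y W k)>>.

Lemma init_adapted G :
  \bigcup_k vec_events (past_y W k) `<=` <<s G>> -> adapted_vec G (init_pred W).
Proof. by move=> sG; apply/adapted_vecP => E /init_past; exact: gen_sub. Qed.

Lemma info_estimate e t : adapted_vec (info_gens e t) (estimate S W e0 t).
Proof.
apply: estimate_adapted => [|k]; last exact: info_output.
by apply: init_adapted => E yE; apply: sub_gen_smallest; left; left.
Qed.

Lemma past_output t k : (k < t)%N -> adapted_vec (past_gens t) (output S W e0 k).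
Proof. by move=> kt; apply: adapted_vec_gen => E Ek; right; exists k. Qed.

Lemma past_estimate t : adapted_vec (past_gens t.+1) (estimate S W e0 t).
Proof.
apply: estimate_adapted => [|k kt]; last exact: past_output (kt : (k < t.+1)%N).
by apply: init_adapted => E yE; apply: sub_gen_smallest; left.
Qed.

Lemma past_mono t t' : (t <= t')%N -> <<s past_gens t>> `<=` <<s past_gens t'>>.
Proof.
move=> tt'; apply: sub_sigma_algebra2 => E [yE|[k kt Ek]]; first by left.
by right; exists k => //=; exact: leq_trans tt'.
Qed.

Variable N : nat.

(** Every attack is a function of earlier information; by strong induction on time,
    it is a function of the unattacked outputs. *)
Lemma info_past e t : admissible S W N e -> (t <= N.+1)%N ->
  <<s info_gens e t>> `<=` <<s past_gens t.+1>>.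
Proof.
move=> adm; elim/ltn_ind: t => t IH tN.
have me k : (k < t)%N -> adapted_vec (past_gens t.+1) (e k).
  move=> kt; have kN : (k <= N)%N by rewrite -ltnS; exact: leq_trans tN.
  apply: adapted_vec_sub (past_mono (_ : k.+1 <= t.+1)%N) _; first exact: ltnW.
  have kN1 : (k <= N.+1)%N by exact: leqW.
  by apply: adapted_vec_sub (IH k kt kN1) _; apply/adapted_vecP; exact: adm.
apply: gen_sub => E [[yE|[k kt]]|[k kt]].
- by apply: sub_gen_smallest; left.
- have mY : adapted_vec (past_gens t.+1) (ytilde S W e k).
    have -> : ytilde S W e k =
        fun w => output S W e0 k w + C *m state_bias S *m theta S e k w.
      by apply/funext => w; exact: ytilde_output.
    apply: measurable_vecD; first exact: past_output.
    by apply: measurable_vec_mulmx; apply: theta_adapted => j jk; apply: me; exact: leq_trans kt.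
  exact: ((adapted_vecP _ _).1 mY).
- exact: ((adapted_vecP _ _).1 (me k kt)).
Qed.

End Information.

(** * Means of quadratic forms *)

Section RealIntegrable.
Context (R : realType) (d : measure_display) (T : measurableType d).
Variable Pr : probability T R.
Implicit Types f g : T -> R.

Definition has_mean f := Pr.-integrable setT (EFin \o f).
Definition mean f := (\int[Pr]_w (f w)%:E)%E.

Lemma has_meanD f g : has_mean f -> has_mean g -> has_mean (fun w => f w + g w).
Proof. by move=> rf rg; exact: (@integrableD _ _ _ _ _ _ (EFin \o f) (EFin \o g)). Qed.

Lemma has_meanB f g : has_mean f -> has_mean g -> has_mean (fun w => f w - g w).
Proof. by move=> rf rg; exact: (@integrableB _ _ _ _ _ _ (EFin \o f) (EFin \o g)). Qed.

Lemma has_meanZ k f : has_mean f -> has_mean (fun w => k * f w).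
Proof. by move=> rf; exact: (@integrableZl _ _ _ _ _ _ k (EFin \o f)). Qed.

Lemma has_mean_sum I (r : seq I) (f : I -> T -> R) : (forall i, has_mean (f i)) ->
  has_mean (fun w => \sum_(i <- r) f i w).
Proof.
move=> rf; elim: r => [|i r IH].
  by under eq_fun do rewrite big_nil; exact: (@integrable0 _ _ _ _ setT).
by under eq_fun do rewrite big_cons; exact: has_meanD.
Qed.

Lemma has_mean_le f g : measurable_fun setT f -> (forall w, `|f w| <= g w) ->
  has_mean g -> has_mean f.
Proof.
move=> mf fg; apply: le_integrable => //; first exact/measurable_EFinP.
by move=> w _ /=; rewrite lee_fin; apply: le_trans (fg w) (ler_norm _).
Qed.

Lemma meanD f g : has_mean f -> has_mean g -> mean (fun w => f w + g w) = (mean f + mean g)%E.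
Proof. by move=> rf rg; rewrite -integralD_EFin. Qed.

Lemma meanB f g : has_mean f -> has_mean g -> mean (fun w => f w - g w) = (mean f - mean g)%E.
Proof. by move=> rf rg; rewrite -integralB_EFin. Qed.

Lemma meanZ k f : has_mean f -> mean (fun w => k * f w) = (k%:E * mean f)%E.
Proof. by move=> rf; rewrite -integralZl. Qed.

Lemma mean_sum0 I (r : seq I) (f : I -> T -> R) : (forall i, has_mean (f i)) ->
  (forall i, mean (f i) = 0%E) -> mean (fun w => \sum_(i <- r) f i w) = 0%E.
Proof.
move=> rf f0; elim: r => [|i r IH].
  rewrite /mean; under eq_integral do rewrite big_nil; exact: integral0.
under [X in mean X]eq_fun do rewrite big_cons.
by rewrite meanD ?f0 ?add0e //; exact: has_mean_sum.
Qed.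

Lemma ge0_has_mean f : measurable_fun setT f -> (forall w, 0 <= f w) ->
  (mean f < +oo)%E -> has_mean f.
Proof.
move=> mf f0 foo; apply/integrableP; split; first exact/measurable_EFinP.
by under eq_integral do rewrite gee0_abs ?lee_fin //.
Qed.

Lemma mean_ge0 f : (forall w, 0 <= f w) -> (0 <= mean f)%E.
Proof. by move=> f0; apply: integral_ge0 => w _; rewrite lee_fin. Qed.

Lemma ge0_meanD f g : measurable_fun setT f -> measurable_fun setT g ->
  (forall w, 0 <= f w) -> (forall w, 0 <= g w) ->
  mean (fun w => f w + g w) = (mean f + mean g)%E.
Proof.
move=> mf mg f0 g0; rewrite -ge0_integralD //; try by move=> w _; rewrite lee_fin.
  exact/measurable_EFinP.
exact/measurable_EFinP.
Qed.

Lemma ge0_ae_mean_le f g : measurable_fun setT f -> measurable_fun setT g ->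
  (forall w, 0 <= f w) -> (forall w, 0 <= g w) ->
  {ae Pr, forall w, f w <= g w} -> (mean f <= mean g)%E.
Proof.
move=> mf mg f0 g0 fg; apply: ae_ge0_le_integral => //.
- by move=> w _; rewrite lee_fin.
- exact/measurable_EFinP.
- by move=> w _; rewrite lee_fin.
- exact/measurable_EFinP.
- by apply: filterS fg => w h _; rewrite lee_fin.
Qed.

Lemma ge0_ae_mean_eq f g : measurable_fun setT f -> measurable_fun setT g ->
  (forall w, 0 <= f w) -> (forall w, 0 <= g w) ->
  {ae Pr, forall w, f w = g w} -> mean f = mean g.
Proof.
move=> mf mg f0 g0 fg; apply/eqP; rewrite eq_le !ge0_ae_mean_le //.
  by apply: filterS fg => w ->.
by apply: filterS fg => w ->.
Qed.

Lemma has_mean_mul f g : measurable_fun setT f -> measurable_fun setT g ->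
  has_mean (fun w => f w ^+ 2) -> has_mean (fun w => g w ^+ 2) ->
  has_mean (fun w => f w * g w).
Proof.
move=> mf mg rf rg; apply: has_mean_le (has_meanD rf rg); first exact: measurable_funM.
move=> w; rewrite normrM -(real_normK (num_real (f w))) -(real_normK (num_real (g w))).
have := sqr_ge0 (`|f w| - `|g w|); have := mulr_ge0 (normr_ge0 (f w)) (normr_ge0 (g w)).
move: (`|f w|) (`|g w|) => x y; rewrite sqrrB; lra.
Qed.

Lemma has_mean_sqrB f g : measurable_fun setT f -> measurable_fun setT g ->
  has_mean (fun w => f w ^+ 2) -> has_mean (fun w => g w ^+ 2) ->
  has_mean (fun w => (f w - g w) ^+ 2).
Proof.
move=> mf mg rf rg; apply: has_mean_le (has_meanZ 2 (has_meanD rf rg)).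
  by apply: measurable_funX; exact: measurable_funB.
move=> w; rewrite ger0_norm ?sqr_ge0 //.
have := sqr_ge0 (f w + g w); rewrite sqrrD sqrrB; lra.
Qed.

Lemma has_mean_qform n (S : 'M[R]_n) (X : T -> 'cV[R]_n) : measurable_vec X ->
  (forall i, has_mean (fun w => X w i 0 ^+ 2)) -> has_mean (fun w => qform S (X w)).
Proof.
move=> mX rX.
have -> : (fun w => qform S (X w)) =
    fun w => \sum_j \sum_i S i j * (X w i 0 * X w j 0).
  apply/funext => w; rewrite /qform mxE; apply: eq_bigr => j _.
  rewrite mxE mulr_suml; apply: eq_bigr => i _; rewrite mxE; ring.
apply: has_mean_sum => j; apply: has_mean_sum => i; apply: has_meanZ; exact: has_mean_mul.
Qed.

End RealIntegrable.

Section Pythagoras.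
Context (R : realType) (d : measure_display) (T : measurableType d).
Variables (Pr : probability T R) (n k : nat) (G : set (set T)).
Hypothesis sG : <<s G>> `<=` measurable.
Variables (Q : 'M[R]_k) (J : 'M[R]_(k, n)) (z : T -> 'cV[R]_k).
Hypotheses (psdQ : possemidef Q) (mz : adapted_vec G z).
Local Notation has_mean := (has_mean Pr).
Local Notation mean := (mean Pr).

Let mTz : measurable_vec z. Proof. exact: adapted_vec_measurable sG mz. Qed.

(** The mixed term is the sum of X_i y_i, where y = J^T Q z.  Each summand is
    integrable although y need not have second moments: as Q is nonnegative at
    z + x J e_i and z - x J e_i, the product |2 x y_i| is at most
    q z + x^2 q (J e_i). *)
Lemma gaussian_cross (X : T -> 'cV[R]_n) (S : 'M[R]_n) :
  gaussian Pr X S -> possemidef S -> independent Pr <<s vec_events X>> <<s G>> ->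
  has_mean (fun w => qform Q (z w)) ->
  has_mean (fun w => ((z w)^T *m Q *m (J *m X w)) 0 0) /\
  mean (fun w => ((z w)^T *m Q *m (J *m X w)) 0 0) = 0%E.
Proof.
move=> gaussX psdS indepX intz; have [symQ Q_ge0] := psdQ.
have mX := gaussian_measurable_vec gaussX.
pose y w := J^T *m Q *m z w.
have mGy : adapted_vec G y by exact: measurable_vec_mulmx.
have my : measurable_vec y by exact: adapted_vec_measurable sG mGy.
have -> : (fun w => ((z w)^T *m Q *m (J *m X w)) 0 0) = fun w => \sum_i X w i 0 * y w i 0.
  apply/funext => w; rewrite -[_ *m _ *m _]trmx11 !trmx_mul trmxK symQ.
  have -> : (X w)^T *m J^T *m (Q *m z w) = (X w)^T *m y w by rewrite /y !mulmxA.
  by rewrite mxE; apply: eq_bigr => i _; rewrite mxE.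
have rXy i : has_mean (fun w => X w i 0 * y w i 0).
  pose c := qform Q (J *m (delta_mx i 0 : 'cV[R]_n)).
  apply: (@has_mean_le _ _ _ _ _ (fun w => qform Q (z w) + c * X w i 0 ^+ 2)).
  - by apply: measurable_funM; [exact: mX|exact: my].
  - move=> w; have yE : y w i 0 = ((z w)^T *m Q *m (J *m (delta_mx i 0 : 'cV[R]_n))) 0 0.
      rewrite -[X in _ = fun_of_matrix X _ _]trmx11 !trmx_mul trmxK symQ trmx_delta.
      by rewrite -!mulmxA -rowE [RHS]mxE /y !mulmxA.
    have pm (x : R) : 0 <= qform Q (z w) + x ^+ 2 * c + (x * y w i 0) *+ 2.
      have := Q_ge0 (z w + x *: (J *m (delta_mx i 0 : 'cV[R]_n))).
      by rewrite qformD // qformZ -scalemxAr mxE -yE.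
    have := pm (X w i 0); have := pm (- X w i 0).
    rewrite sqrrN ler_norml; set q := qform _ _; set a := X w i 0; set b := y w i 0.
    have : 0 <= q by exact: Q_ge0.
    have : 0 <= a ^+ 2 * c by rewrite mulr_ge0 ?sqr_ge0 //; exact: Q_ge0.
    rewrite [c * _]mulrC; move: (a ^+ 2 * c) => r; rewrite mulNr.
    move: (a * b) => ab h1 h2; rewrite !mulr2n => h3 h4; apply/andP; split; lra.
  - apply: (has_meanD intz); apply: (has_meanZ c).
    exact: (gaussian_sqr_integrable gaussX i psdS).
split; first exact: has_mean_sum.
apply: mean_sum0 => [//|i].
exact: (gaussian_orthogonal gaussX sG indepX (mGy i) (rXy i)).
Qed.

(** The variables X and X' may depend on each other; the independence from G of each
    of them separately is enough to cancel the mixed terms. *)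
Lemma mean_qform_shift (X X' : T -> 'cV[R]_n) (S S' : 'M[R]_n) :
  gaussian Pr X S -> possemidef S -> independent Pr <<s vec_events X>> <<s G>> ->
  gaussian Pr X' S' -> possemidef S' -> independent Pr <<s vec_events X'>> <<s G>> ->
  mean (fun w => qform Q (z w + J *m (X w - X' w))) =
    (mean (fun w => qform Q (z w)) + mean (fun w => qform Q (J *m (X w - X' w))))%E.
Proof.
move=> gX psdS iX gX' psdS' iX'; have [symQ Q_ge0] := psdQ.
have mX := gaussian_measurable_vec gX; have mX' := gaussian_measurable_vec gX'.
pose a w := J *m (X w - X' w).
have ma : measurable_vec a by apply: measurable_vec_mulmx; exact: measurable_vecB.
have ra : has_mean (fun w => qform Q (a w)).
  under [X in has_mean X]eq_fun do rewrite qform_mulmx.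
  apply: has_mean_qform => [|i]; first exact: measurable_vecB.
  under [X in has_mean X]eq_fun do rewrite !mxE.
  apply: has_mean_sqrB; [exact: mX|exact: mX'| |].
    exact: (gaussian_sqr_integrable gX i psdS).
  exact: (gaussian_sqr_integrable gX' i psdS').
have mqz := measurable_vec_qform Q mTz; have mqa := measurable_vec_qform Q ma.
have mqza := measurable_vec_qform Q (measurable_vecD mTz ma).
have [zoo|] := ltP (mean (fun w => qform Q (z w))) +oo%E.
  have rz : has_mean (fun w => qform Q (z w)) by apply: ge0_has_mean.
  have [rc c0] := gaussian_cross gX psdS iX rz.
  have [rc' c0'] := gaussian_cross gX' psdS' iX' rz.
  pose cross w := ((z w)^T *m Q *m (J *m X w)) 0 0 - ((z w)^T *m Q *m (J *m X' w)) 0 0.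
  have -> : (fun w => qform Q (z w + J *m (X w - X' w))) =
      fun w => (qform Q (z w) + qform Q (a w)) + 2 * cross w.
    apply/funext => w; rewrite qformD // /cross /a mulmxBr mulmxBr.
    by rewrite [X in X *+ 2]mxE [X in (_ + X) *+ 2]mxE mulr2n mulrDl mul1r.
  have rcross : has_mean cross by exact: has_meanB.
  rewrite meanD; [|exact: has_meanD|exact: has_meanZ].
  by rewrite meanD // meanZ // /cross meanB // c0 c0' subee // mule0 adde0.
rewrite leye_eq => /eqP zoo; rewrite zoo.
have zza w : qform Q (z w) <= 2 * qform Q (z w + a w) + 2 * qform Q (a w).
  have := Q_ge0 (z w + 2 *: a w).
  rewrite !qformD // qformZ -scalemxAr [fun_of_matrix (_ *: _) _ _]mxE !mulr2n; lra.
have [loo|] := ltP (mean (fun w => qform Q (z w + a w))) +oo%E.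
  have rza : has_mean (fun w => qform Q (z w + a w)) by exact: ge0_has_mean.
  have rz : has_mean (fun w => qform Q (z w)).
    apply: has_mean_le (has_meanD (has_meanZ 2 rza) (has_meanZ 2 ra)) => // w.
    by rewrite ger0_norm.
  by have := integrable_lty measurableT rz; rewrite -/(mean _) zoo ltxx.
rewrite leye_eq => /eqP ->; rewrite addye //.
by rewrite gt_eqF // (lt_le_trans ltNy0) // mean_ge0.
Qed.

End Pythagoras.

(** * The attack law and its optimality *)

Section Existence.
Context (R : realType) (n m p s : nat) (S : plant R n m p s).
Context (d : measure_display) (T : measurableType d).
Variables (Pr : probability T R) (W : disturbances R n p T) (xstar : 'cV[R]_n).
Variables (N : nat) (Q : nat -> 'M[R]_n).
Local Notation e0 := (@no_attack R s d T).
Implicit Types (e : nat -> T -> 'cV[R]_s).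

(** The augmented state at time t depends on the attack before time t only, hence the
    feedback law defines an attack by recursion. *)
Lemma xi_causal e e' t : (forall k, (k < t)%N -> e k = e' k) ->
  xi Pr S W xstar e t = xi Pr S W xstar e' t.
Proof.
move=> ee'.
have loopE k w : (k <= t)%N -> loop S W e k w = loop S W e' k w.
  by elim: k => [//|k IH] kt; rewrite /= IH ?ee' // ltnW.
have thE k w : (k <= t)%N -> theta S e k w = theta S e' k w.
  by elim: k => [//|k IH] kt; rewrite /= IH ?ee' // ltnW.
have stE k : (k <= t)%N -> state S W e k = state S W e' k.
  by move=> kt; apply/funext => w; rewrite /state loopE.
have infoE : info S W e t = info S W e' t.
  have yE : \bigcup_(k in [set k | (k <= t)%N]) vec_events (ytilde S W e k) =
            \bigcup_(k in [set k | (k <= t)%N]) vec_events (ytilde S W e' k).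
    by apply: eq_bigcupr => k kt; rewrite /ytilde stE.
  have eE : \bigcup_(k in [set k | (k < t)%N]) vec_events (e k) =
            \bigcup_(k in [set k | (k < t)%N]) vec_events (e' k).
    by apply: eq_bigcupr => k kt; rewrite ee'.
  pose gen Y E := <<s (\bigcup_k vec_events (past_y W k)) `|` Y `|` E >>.
  exact: (f_equal2 gen yE eE).
have xtE : xtilde Pr S W e t = xtilde Pr S W e' t.
  exact: (f_equal2 (vcondE Pr (n := n)) infoE (stE t (leqnn t))).
apply/funext => w.
exact: (f_equal2 (fun x th => col_mx x (col_mx th (col_mx (estimate S W e0 t w) xstar)))
  (congr1 (@^~ w) xtE) (thE t w (leqnn t))).
Qed.

(** The k-th approximation follows the law at all times before k, and later
    approximations do not change it there. *)
Lemma law_exists : exists e, follows_law Pr S W N xstar Q e.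
Proof.
pose step e t w := attack_law S N Q t (xi Pr S W xstar e t w).
pose approx := fix approx k := if k is k'.+1 then step (approx k') else e0.
have stepE e e' t : (forall k, (k < t)%N -> e k = e' k) -> step e t = step e' t.
  by move=> ee'; apply/funext => w; rewrite /step (xi_causal ee').
have approxS k t : (t < k)%N -> approx k t = approx k.+1 t.
  elim: k t => [//|k IH] t tk; apply: stepE => j jt.
  by apply: IH; exact: (leq_trans jt tk).
have approxE k t : (t < k)%N -> approx k t = approx t.+1 t.
  elim: k => [//|k IH]; rewrite ltnS leq_eqVlt => /orP[/eqP -> //|tk].
  by rewrite -approxS // IH.
exists (fun t => approx t.+1 t) => t _ w.
have -> : approx t.+1 t = step (approx t) t by [].
by rewrite (stepE _ (fun t => approx t.+1 t)) // => k kt; exact: approxE.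
Qed.

End Existence.

Section Optimality.
Context (R : realType) (n m p s : nat) (S : plant R n m p s).
Context (d : measure_display) (T : measurableType d).
Variables (Pr : probability T R) (W : disturbances R n p T) (xstar : 'cV[R]_n).
Variables (N : nat) (Q : nat -> 'M[R]_n).
Hypotheses (pdv : posdef (covv S)) (psdP : possemidef (covP S)).
Hypotheses (hnoise : noise_model Pr S W) (hsteady : steady_state Pr S W).
Hypothesis hQ : forall t : nat, (t <= N)%N -> posdef (Q t).
Local Notation A := (matA S).
Local Notation B := (matB S).
Local Notation C := (matC S).
Local Notation L := (gainL S).
Local Notation K := (gainK S).
Local Notation e0 := (@no_attack R s d T).
Local Notation past_gens := (past_gens S W).
Local Notation info_gens := (info_gens S W).
Local Notation kxi := (kalman_xi S W xstar).
Local Notation corr := (correction S W).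
Local Notation mean := (mean Pr).
Local Notation value := (value S N Q).
Local Notation stage := (stage Q).
Implicit Types (e : nat -> T -> 'cV[R]_s).

Let psdQ t : (t <= N)%N -> possemidef (Q t).
Proof. by move=> /hQ; exact: posdef_semidef. Qed.

Let init_past : vec_events (init_pred W) `<=` <<s \bigcup_k vec_events (past_y W k)>>.
Proof. by case: hsteady. Qed.

Lemma past_y_measurable : \bigcup_k vec_events (past_y W k) `<=` measurable.
Proof. by case: hnoise => my _ _ _ E [k _]; exact: my. Qed.

Lemma nominal_measurable t :
  measurable_vec (state S W e0 t) /\ measurable_vec (prediction S W e0 t).
Proof.
have [_ gw gv _] := hnoise; have [_ _ errs _] := hsteady.
have mi : measurable_vec (init_pred W).
  apply: (adapted_vec_measurable (gen_measurable past_y_measurable)).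
  by apply: init_adapted => // E; exact: sub_gen_smallest.
elim: t => [|t [IHx IHp]].
  split=> //; have [g0 _] := errs 0%N.
  have -> : state S W e0 0 = fun w => (state S W e0 0 w - prediction S W e0 0 w) + init_pred W w.
    by apply/funext => w; rewrite /prediction /= subrK.
  by apply: measurable_vecD => //; exact: gaussian_measurable_vec g0.
have mo : measurable_vec (output S W e0 t).
  apply: measurable_vecD; last exact: gaussian_measurable_vec (gv t).
  apply: measurable_vecD; first exact: measurable_vec_mulmx.
  exact: measurable_vec_mulmx (measurable_vec_cst _).
have mxh : measurable_vec (estimate S W e0 t).
  apply: measurable_vecD => //; apply: measurable_vec_mulmx.
  by apply: measurable_vecB => //; exact: measurable_vec_mulmx.
split.
  apply: measurable_vecD; last exact: gaussian_measurable_vec (gw t).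
  apply: measurable_vecD; last exact: measurable_vec_mulmx (measurable_vec_cst _).
  by apply: measurable_vecD; apply: measurable_vec_mulmx => //; exact: measurable_vec_mulmx.
by apply: measurable_vecD; apply: measurable_vec_mulmx => //; exact: measurable_vec_mulmx.
Qed.

Lemma past_measurable t : <<s past_gens t>> `<=` measurable.
Proof.
have [_ _ gv _] := hnoise.
apply: gen_measurable => E [|[k _]]; first exact: past_y_measurable.
apply: vec_events_measurable.
have [mx _] := nominal_measurable k.
apply: measurable_vecD; last exact: gaussian_measurable_vec (gv k).
apply: measurable_vecD; first exact: measurable_vec_mulmx.
exact: measurable_vec_mulmx (measurable_vec_cst _).
Qed.

Lemma info_measurable e t : admissible S W N e -> (t <= N.+1)%N ->
  <<s info_gens e t>> `<=` measurable.
Proof.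
move=> adm tN E /(info_past adm tN).
exact: past_measurable.
Qed.

(** The difference between the state and the claimed conditional mean is the error of
    the unattacked filter, which is independent of the unattacked outputs, hence
    of what the attacker knows, and has mean zero. *)
Lemma xtilde_kalman e t : admissible S W N e -> (t <= N.+1)%N ->
  {ae Pr, forall w, xtilde Pr S W e t w =
    estimate S W e0 t w + state_bias S *m theta S e t w}.
Proof.
move=> adm tN; have [_ _ _ errs] := hsteady.
have [gauss indep] := errs t.
have psdPhat := possemidef_covPhat psdP pdv.
have sP := @past_measurable t.+1.
pose Z w := estimate S W e0 t w + state_bias S *m theta S e t w.
have key i : {ae Pr, forall w, xtilde Pr S W e t w i 0 = Z w i 0}.
  have diff w : state S W e t w i 0 - Z w i 0 = (state S W e0 t w - estimate S W e0 t w) i 0.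
    rewrite /Z; have [-> _] := loop_theta S W e t w.
    by rewrite !mxE; ring.
  have mZ : adapted_vec (info_gens e t) Z.
    apply: measurable_vecD; first exact: info_estimate.
    by apply: measurable_vec_mulmx; exact: info_theta.
  have : is_condE Pr <<s info_gens e t>> (fun w => state S W e t w i 0) (fun w => Z w i 0).
    apply: is_condE_shift; [exact: info_measurable|exact: mZ| |].
      under [X in EFin \o X]eq_fun do rewrite diff.
      exact: gaussian_integrable gauss i psdPhat.
    move=> E /(info_past adm tN) pE.
    under eq_integral do rewrite diff.
    have h := gaussian_integral0 gauss sP indep i psdPhat pE.
    exact: h.
  move=> /(condE_version (info_measurable adm tN)); apply: filterS => w <-.
  by rewrite mxE.
have : {ae Pr, forall w, forall i, xtilde Pr S W e t w i 0 = Z w i 0}.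
  exact: filter_forall.
apply: filterS => w h.
by apply/matrixP => i j; rewrite ord1.
Qed.

Lemma xi_kalman e t : admissible S W N e -> (t <= N.+1)%N ->
  {ae Pr, forall w, xi Pr S W xstar e t w = kxi e t w}.
Proof.
move=> adm tN; have := xtilde_kalman adm tN; apply: filterS => w h.
by rewrite /xi h.
Qed.

Lemma theta_past e t : admissible S W N e -> (t <= N.+1)%N ->
  adapted_vec (past_gens t.+1) (theta S e t).
Proof.
move=> adm tN; apply: adapted_vec_sub (info_past adm tN) _; exact: info_theta.
Qed.

Lemma kalman_xi_past e t : admissible S W N e -> (t <= N.+1)%N ->
  adapted_vec (past_gens t.+1) (kxi e t).
Proof.
move=> adm tN; have mth := theta_past adm tN.
have mest : adapted_vec (past_gens t.+1) (estimate S W e0 t) by exact: past_estimate.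
apply: measurable_vec_col; first by apply: measurable_vecD => //; exact: measurable_vec_mulmx.
by apply: measurable_vec_col => //; apply: measurable_vec_col => //; exact: measurable_vec_cst.
Qed.

Lemma xi_info e t : adapted_vec (info_gens e t) (xi Pr S W xstar e t).
Proof.
apply: measurable_vec_col.
  by move=> i; under eq_fun do rewrite mxE; exact: condE_measurable.
apply: measurable_vec_col; first exact: info_theta.
apply: measurable_vec_col; [exact: info_estimate|exact: measurable_vec_cst].
Qed.

Definition noise_cost t := mean (fun w => value t (noise_in R n *m corr t w)).

(** The prediction error at time t + 1 and the filtering error at time t + 1 are both
    independent of the outputs up to time t, the latter because it is even
    independent of the outputs up to time t + 1. *)
Lemma mean_value_step e t : admissible S W N e -> (t <= N)%N ->
  mean (fun w => value t.+1 (kxi e t.+1 w)) =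
  (mean (fun w => value t.+1 (calA S *m kxi e t w + calB S *m e t w)) + noise_cost t.+1)%E.
Proof.
move=> adm tN; have [_ _ errp erre] := hsteady.
have [gp ip] := errp t.+1; have [ge ie] := erre t.+1.
have tN1 : (t <= N.+1)%N by exact: leqW.
have mz : adapted_vec (past_gens t.+1) (fun w => calA S *m kxi e t w + calB S *m e t w).
  apply: measurable_vecD; apply: measurable_vec_mulmx; first exact: kalman_xi_past.
  apply: adapted_vec_sub (info_past adm tN1) _; apply/adapted_vecP; exact: adm.
have ie' : independent Pr
    <<s vec_events (fun w => state S W e0 t.+1 w - estimate S W e0 t.+1 w)>>
    <<s past_gens t.+1>>.
  by move=> E F sE /(past_mono (leqnSn _)) sF; exact: ie.
have psdV : possemidef (riccQ S N Q t.+1) by exact: possemidef_riccQ.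
have psdPhat := possemidef_covPhat psdP pdv.
have := mean_qform_shift (@past_measurable _) (noise_in R n) psdV mz gp psdP ip ge psdPhat ie'.
rewrite /noise_cost /value => h.
have corrE w : corr t.+1 w = (state S W e0 t.+1 w - prediction S W e0 t.+1 w) -
    (state S W e0 t.+1 w - estimate S W e0 t.+1 w).
  by rewrite /correction opprB [RHS]addrC addrA subrK.
under [X in mean X]eq_fun do rewrite kalman_xiS corrE.
rewrite h; congr (_ + mean _)%E.
by apply/funext => w; rewrite corrE.
Qed.

Let stage_ge0 t xi : (t <= N)%N -> 0 <= stage t xi.
Proof. by move=> tN; have [_] := psdQ tN; exact. Qed.

Let value_ge0 t xi : (t <= N.+1)%N -> 0 <= value t xi.
Proof. by move=> tN; have [_] := possemidef_riccQ S psdQ tN; exact. Qed.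

Let psdnu : posdef (covnu S).
Proof. exact: posdef_covnu. Qed.

(** Read backwards from the end of the horizon: at every time the rest of the
    attack itself witnesses that the bias can be kept at zero. *)
Lemma feasible_silent e : feasible Pr S W N 0 e ->
  {ae Pr, forall w, forall t, (t <= N)%N -> silent S (N - t) (theta S e t w) (e t w)}.
Proof.
move=> feas.
have : {ae Pr, forall w, forall t, (t <= N)%N -> bias S W e t w = 0}.
  apply: ae_foralln => t; case: (leqP t N) => [tN|Nt]; last by apply: aeW.
  apply: filterS (feas t tN) => w; rewrite /wnorm.
  have [_ inv_gt0] := posdef_inv psdnu.
  have [-> //|nz] := eqVneq (bias S W e t w) 0.
  have pos := inv_gt0 _ nz; by rewrite sqr_sqrtr ?(ltW pos) // leNgt pos.
apply: filterS => w bias0.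
have ker k : (k <= N.+1)%N -> riccPhat S k *m theta S e (N.+1 - k) w = 0.
  elim: k => [|k IH] kN; first by rewrite mul0mx.
  apply/riccPhat_kerP => //; exists (e (N - k)%N w); rewrite subSS; split.
    by have := IH (ltnW kN); rewrite subSn.
  by rewrite -(bias_theta S W) bias0 // leq_subr.
move=> t tN; split.
  by have := ker (N - t)%N (leq_trans (leq_subr _ _) (leqnSn _)); rewrite subSn ?leq_subr // subKn.
by rewrite -(bias_theta S W) bias0.
Qed.

(** Initially theta = 0 lies in every kernel; from then on the law solves the linear
    constraint whenever it is solvable, and thereby keeps it solvable. *)
Lemma law_silent e t w : follows_law Pr S W N xstar Q e -> (t <= N)%N ->
  silent S (N - t) (theta S e t w) (e t w).
Proof.
move=> law.
have thE k : calG R n *m xi Pr S W xstar e k w = theta S e k w.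
  by rewrite /xi /calG !mul_row_col !mul0mx mul1mx !addr0 add0r.
have step k : (k <= N)%N -> riccPhat S (N.+1 - k) *m theta S e k w = 0 ->
    silent S (N - k) (theta S e k w) (e k w).
  move=> kN; rewrite subSn // riccPhat_kerP // => ex.
  by rewrite law // attack_lawE -thE; apply: silent_sat; rewrite // thE.
have ker k : (k <= N.+1)%N -> riccPhat S (N.+1 - k) *m theta S e k w = 0.
  elim: k => [|k IH] kN; first by rewrite mulmx0.
  by have [] := step k kN (IH (ltnW kN)).
by move=> tN; apply: step => //; apply: ker; exact: leqW.
Qed.

Lemma law_feasible e : follows_law Pr S W N xstar Q e -> feasible Pr S W N 0 e.
Proof.
move=> law t tN; apply: aeW => w.
have [_ b0] := law_silent w law tN.
by rewrite bias_theta b0 /wnorm qform0 sqrtr0 expr0n.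
Qed.

Lemma law_admissible e : follows_law Pr S W N xstar Q e -> admissible S W N e.
Proof.
move=> law t tN; apply: (adapted_vecP _ _).1.
have -> : e t = fun w => (calF S N t *m - ((((calB S *m calF S N t)^T *m riccQ S N Q t.+1
    *m (calB S *m calF S N t))^† *m ((calB S *m calF S N t)^T *m riccQ S N Q t.+1
    *m calAcl S N t))) - calDC S N t) *m xi Pr S W xstar e t w.
  apply/funext => w; rewrite law // attack_lawE /minimizer mulmxBl; congr (_ - _).
  by rewrite !mulmxN mulNmx !mulmxA.
by apply: measurable_vec_mulmx; exact: xi_info.
Qed.

Definition mean_stage e t := mean (fun w => stage t (kxi e t w)).
Definition mean_value e t := mean (fun w => value t (kxi e t w)).

Lemma kalman_xi_measurable e t : admissible S W N e -> (t <= N.+1)%N ->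
  measurable_vec (kxi e t).
Proof.
move=> adm tN; apply: adapted_vec_measurable (@past_measurable t.+1) _.
exact: kalman_xi_past.
Qed.

Lemma attack_measurable e t : admissible S W N e -> (t <= N)%N -> measurable_vec (e t).
Proof.
move=> adm tN; apply: adapted_vec_measurable (info_measurable adm (leqW tN)) _.
by apply/adapted_vecP; exact: adm.
Qed.

Lemma stage_measurable (X : T -> 'cV[R]_(dimxi n)) t : measurable_vec X ->
  measurable_fun setT (fun w => stage t (X w)).
Proof. by move=> mX; apply: measurable_vec_qform; exact: measurable_vec_mulmx. Qed.

Lemma bellman_mean e t (adm : admissible S W N e) (tN : (t <= N)%N) :
  (mean_stage e t + mean (fun w => value t.+1 (calA S *m kxi e t w + calB S *m e t w)) =
  mean (fun w => stage t (kxi e t w)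
                 + value t.+1 (calA S *m kxi e t w + calB S *m e t w))%R)%E.
Proof.
rewrite ge0_meanD //.
- by apply: stage_measurable; apply: kalman_xi_measurable => //; exact: leqW.
- apply: measurable_vec_qform; apply: measurable_vecD; apply: measurable_vec_mulmx;
    last exact: attack_measurable.
  by apply: kalman_xi_measurable => //; exact: leqW.
- by move=> w; exact: stage_ge0.
- by move=> w; exact: value_ge0.
Qed.

Lemma calG_kalman_xi e t w : calG R n *m kxi e t w = theta S e t w.
Proof. by rewrite /kalman_xi /calG !mul_row_col !mul0mx mul1mx !addr0 add0r. Qed.

Let next_measurable e t : admissible S W N e -> (t <= N)%N ->
  measurable_fun setT
    (fun w => stage t (kxi e t w) + value t.+1 (calA S *m kxi e t w + calB S *m e t w)).
Proof.
move=> adm tN; have mk := kalman_xi_measurable adm (leqW tN).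
apply: measurable_funD; first exact: stage_measurable.
apply: measurable_vec_qform; apply: measurable_vecD;
  apply: measurable_vec_mulmx => //; exact: attack_measurable.
Qed.

(** This is the mean of [bellman_le], which holds almost surely for a feasible
    attack; the constant is the contribution of the correction. *)
Lemma mean_value_le e t : admissible S W N e -> feasible Pr S W N 0 e -> (t <= N)%N ->
  (mean_value e t + noise_cost t.+1 <= mean_stage e t + mean_value e t.+1)%E.
Proof.
move=> adm feas tN; rewrite [mean_value e t.+1]mean_value_step // [leRHS]addeA bellman_mean //.
apply: leeD2r; apply: ge0_ae_mean_le.
- by apply: measurable_vec_qform; exact: kalman_xi_measurable (leqW tN).
- exact: next_measurable.
- by move=> w; apply: value_ge0; exact: leqW.
- by move=> w; rewrite addr_ge0 ?stage_ge0 ?value_ge0.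
- apply: filterS (feasible_silent feas) => w sil; apply: bellman_le => //.
  by rewrite calG_kalman_xi; exact: sil.
Qed.

Lemma mean_value_eq e t : follows_law Pr S W N xstar Q e -> (t <= N)%N ->
  (mean_value e t + noise_cost t.+1 = mean_stage e t + mean_value e t.+1)%E.
Proof.
move=> law tN; have adm := law_admissible law.
rewrite [mean_value e t.+1]mean_value_step // [RHS]addeA bellman_mean //.
congr (_ + _)%E.
apply: ge0_ae_mean_eq.
- by apply: measurable_vec_qform; exact: kalman_xi_measurable (leqW tN).
- exact: next_measurable.
- by move=> w; apply: value_ge0; exact: leqW.
- by move=> w; rewrite addr_ge0 ?stage_ge0 ?value_ge0.
- apply: filterS (xi_kalman adm (leqW tN)) => w xiE.
  by rewrite (law t tN) xiE; exact: bellman_eq.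
Qed.

Lemma mean_value0 e : mean_value e N.+1 = 0%E.
Proof.
rewrite /mean_value /value /riccQ subnn /mean; apply: integral0_eq => w _.
by rewrite /qform mulmx0 mul0mx mxE.
Qed.

Definition total_noise := (\sum_(t < N.+1) noise_cost t.+1)%E.
Definition total_stage e := (\sum_(t < N.+1) mean_stage e t)%E.

Lemma total_stage_ge e : admissible S W N e -> feasible Pr S W N 0 e ->
  (mean_value e 0 + total_noise <= total_stage e)%E.
Proof.
move=> adm feas; rewrite -[leRHS]adde0 -(mean_value0 e) /total_noise /total_stage.
suff H k : (k <= N.+1)%N -> (mean_value e 0 + \sum_(t < k) noise_cost t.+1 <=
    \sum_(t < k) mean_stage e t + mean_value e k)%E by exact: H.
elim: k => [|k IH] kN; first by rewrite !big_ord0 adde0 add0e.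
rewrite !big_ord_recr /= addeA; apply: le_trans (leeD2r _ (IH (ltnW kN))) _.
by rewrite -addeA -[leRHS]addeA; apply: leeD2l; exact: (mean_value_le adm feas kN).
Qed.

Lemma total_stage_law e : follows_law Pr S W N xstar Q e ->
  (total_stage e = mean_value e 0 + total_noise)%E.
Proof.
move=> law; rewrite -[LHS]adde0 -(mean_value0 e) /total_noise /total_stage.
suff H k : (k <= N.+1)%N -> (mean_value e 0 + \sum_(t < k) noise_cost t.+1 =
    \sum_(t < k) mean_stage e t + mean_value e k)%E by rewrite H.
elim: k => [|k IH] kN; first by rewrite !big_ord0 adde0 add0e.
rewrite !big_ord_recr /= addeA IH ?(ltnW kN) // -[LHS]addeA -[RHS]addeA.
by rewrite (mean_value_eq law kN).
Qed.

(** The cost is stated with the chosen version of the conditional mean, which may be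
    replaced by its closed form inside an integral. *)
Lemma cost_total_stage e : admissible S W N e ->
  cost Pr S W N xstar Q e =
  ((\sum_(t < N.+1) \tr (covPhat S *m Q t))%R%:E + total_stage e)%E.
Proof.
move=> adm; rewrite /cost; congr (_ + _)%E; rewrite unlock.
have mxi t : (t <= N.+1)%N -> measurable_vec (xi Pr S W xstar e t).
  by move=> tN; apply: adapted_vec_measurable (info_measurable adm tN) _; exact: xi_info.
under eq_integral => w _.
  rewrite -sumEFin.
  under eq_bigr => t _.
    rewrite /wnorm sqr_sqrtr; last by apply: stage_ge0; rewrite -ltnS.
    over.
  over.
rewrite ge0_integral_sum //.
- apply: eq_bigr => t _; have tN : (t <= N)%N by rewrite -ltnS.
  apply: (@ge0_ae_mean_eq _ _ _ Pr (fun w => stage t (xi Pr S W xstar e t w))).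
  + by apply: stage_measurable; apply: mxi; exact: leqW.
  + by apply: stage_measurable; apply: kalman_xi_measurable => //; exact: leqW.
  + by move=> w; exact: stage_ge0.
  + by move=> w; exact: stage_ge0.
  + by apply: filterS (xi_kalman adm (leqW tN)) => w ->.
- move=> t; apply/measurable_EFinP; apply: stage_measurable; apply: mxi.
  by apply: leqW; rewrite -ltnS.
- by move=> t w _; rewrite lee_fin; apply: stage_ge0; rewrite -ltnS.
Qed.

(** At time 0 the state theta vanishes, so the lower bound of [total_stage_ge] is the
    same number for all attacks. *)
Lemma law_solves e : follows_law Pr S W N xstar Q e -> solves Pr S W N xstar Q 0 e.
Proof.
move=> law; have adm := law_admissible law.
split; [exact: adm|exact: law_feasible|move=> e' adm' feas'].
rewrite (cost_total_stage adm) (cost_total_stage adm'); apply: leeD2l.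
rewrite (total_stage_law law).
exact: total_stage_ge adm' feas'.
Qed.

End Optimality.

Theorem theorem1 (R : realType) (n m p s N : nat) (S : plant R n m p s)
    (d : measure_display) (T : measurableType d) (Pr : probability T R)
    (W : disturbances R n p T) (xstar : 'cV[R]_n) (Q : nat -> 'M[R]_n)
    (hobs : observable (matA S) (matC S))
    (hctr : controllable (matA S) (matB S))
    (hinj : injective (fun a : 'cV[R]_s => col_mx (matGamma S) (matPsi S) *m a))
    (hcovw : posdef (covw S)) (hcovv : posdef (covv S))
    (hcovP : possemidef (covP S)) (hricc : riccati_P S)
    (hL : schur_stable (matA S + matB S *m gainL S))
    (hnoise : noise_model Pr S W) (hsteady : steady_state Pr S W)
    (hQ : forall t : nat, (t <= N)%N -> posdef (Q t)) :
  (exists e : nat -> T -> 'cV[R]_s, follows_law Pr S W N xstar Q e) /\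
  (forall e : nat -> T -> 'cV[R]_s,
     follows_law Pr S W N xstar Q e -> solves Pr S W N xstar Q 0 e).
Proof.
split=> [|e]; first exact: law_exists.
exact: (law_solves hcovv hcovP hnoise hsteady hQ).
Qed.
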